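(* Let $\rho\in(0,1)$ be fixed, and let $\varepsilon_0\in(0,\min\{\rho,1-\rho\}]$ and $\kappa\ge0$ be given. There exist constants $C_0=C_0(\varepsilon_0,\kappa)$ and $\delta_0=\delta_0(\varepsilon_0,\kappa)>0$ such that $$H_n(t)\le C_0e^{-\delta_0t}$$ for every $n\in\{2,3,\dots\}$, every $u_0\in\mathcal U_{\varepsilon_0,\kappa}$ and every $t\ge0$, where $H_n(t):=H_{\nu_t^n}(f_t^n)$ and $f_t^n$ is the Radon–Nikodym derivative of $\mu_t^n$ with respect to $\nu_t^n$.
   Context: For $n\in\{2,3,\dots\}$ let $\Lambda_n:=\{1,\dots,n-1\}$ and $\Omega_n:=\{0,1\}^{\Lambda_n}$. For $\eta\in\Omega_n$, $\eta^{x,y}$ denotes the configuration obtained from $\eta$ by exchanging the values $\eta(x)$ and $\eta(y)$, and $\eta^x$ the configuration obtained by replacing $\eta(x)$ by $1-\eta(x)$. For $f:\Omega_n\to\mathbb R$ put $\nabla_{x,y}f(\eta)=f(\eta^{x,y})-f(\eta)$ and $\nabla_xf(\eta)=f(\eta^x)-f(\eta)$. The symmetric simple exclusion process with reservoir density $\rho\in(0,1)$ is the continuous-time Markov chain $\{\eta_t:t\ge0\}$ on $\Omega_n$ with generator $$\mathfrak L_nf(\eta)=n^2\sum_{x=1}^{n-2}\nabla_{x,x+1}f(\eta)+n^2\sum_{x\in\{1,n-1\}}\big(\rho(1-\eta(x))+(1-\rho)\eta(x)\big)\nabla_xf(\eta).$$ $\mathcal U_{\varepsilon_0,\kappa}$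 is the family of differentiable functions $u:[0,1]\to[0,1]$ such that $\varepsilon_0\le u(x)\le1-\varepsilon_0$ for every $x\in[0,1]$, $u(0)=u(1)=\rho$, and $|u'(x)|\le\kappa$ for every $x\in[0,1]$. For $u:\Lambda_n\to[0,1]$ let $\nu^n_{u(\cdot)}(\eta):=\prod_{x\in\Lambda_n}\{\eta(x)u(x)+(1-\eta(x))(1-u(x))\}$ be the Bernoulli product measure on $\Omega_n$ with density $u$. Given $u_0\in\mathcal U_{\varepsilon_0,\kappa}$, let $\nu_0^n$ be the Bernoulli product measure with density $x\mapsto u_0(x/n)$, $x\in\Lambda_n$; the chain is started from $\nu_0^n$, $\mathbb E_{\nu_0^n}$ denotes the corresponding expectation, and $\mu_t^n$ is the law of $\eta_t$. Let $u_t^n(x):=\mathbb E_{\nu_0^n}[\eta_t(x)]$ for $x\in\Lambda_n$ and let $\nu_t^n:=\nu^n_{u_t^n(\cdot)}$ be the Bernoulli product measure with density $u_t^n$. For a probability measure $\nu$ on $\Omega_n$ and a density $f$ with respect to $\nu$ (i.e. $f\ge0$, $\int f\,d\nu=1$), the relative entropy is $H_\nu(f):=\int f\log f\,d\nu$ (with $0\log0=0$). *)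

(* Defs.v *)
From HB Require Import structures.
From mathcomp Require Export all_boot all_order all_fingroup all_algebra.
From mathcomp Require Export all_classical all_reals all_analysis.

Set Implicit Arguments.
Unset Strict Implicit.
Unset Printing Implicit Defensive.

Export Order.TTheory GRing.Theory Num.Theory.
Export numFieldNormedType.Exports.

#[global] Open Scope classical_set_scope.
#[global] Open Scope ring_scope.

(* Lambda_n = {1, ..., n-1}: the ordinal x : 'I_n.-1 stands for the point
   x.+1. *)
Definition lattice (n : nat) := 'I_n.-1.
HB.instance Definition _ n := Finite.on (lattice n).

Definition site (n : nat) (x : lattice n) : nat := x.+1.

Definition config (n : nat) := {ffun lattice n -> bool}.
HB.instance Definition _ n := Finite.on (config n).
HB.instance Definition _ n := isPointed.Build (config n) [ffun=> false].
HB.instance Definition _ n :=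
  @isMeasurable.Build default_measure_display (config n) discrete_measurable
    discrete_measurable0 discrete_measurableC discrete_measurableU.

Definition exchange (n : nat) (eta : config n) (x y : lattice n) : config n :=
  [ffun z => eta (tperm x y z)].

Definition flip (n : nat) (eta : config n) (x : lattice n) : config n :=
  [ffun z => if z == x then ~~ eta z else eta z].

Section Exclusion.
Variable R : realType.

(* For n = 2 the two boundary sites coincide and the second sum has a single
   term, as a sum over the set {1, n-1}. *)
Definition ssep_generator (rho : R) (n : nat) (f : config n -> R)
    (eta : config n) : R :=
  n%:R ^+ 2 * (\sum_(x : lattice n) \sum_(y : lattice n | site y == (site x).+1)
                 (f (exchange eta x y) - f eta))
  + n%:R ^+ 2 * (\sum_(x : lattice n | (site x == 1%N) || (site x == n.-1))
      (rho * (1 - (eta x)%:R) + (1 - rho) * (eta x)%:R)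
        * (f (flip eta x) - f eta)).

(* p t eta xi is the probability of going from eta to xi in time t; only the
   values at t >= 0 matter. *)
Definition transition_function (n : nat)
    (p : R -> config n -> config n -> R) : Prop :=
  [/\ forall t eta xi, 0 <= t -> 0 <= p t eta xi,
      forall t eta, 0 <= t -> \sum_xi p t eta xi = 1,
      forall eta xi, p 0 eta xi = (eta == xi)%:R &
      forall s t eta xi, 0 <= s -> 0 <= t ->
        p (s + t) eta xi = \sum_zeta p s eta zeta * p t zeta xi].

Definition has_generator (n : nat) (p : R -> config n -> config n -> R)
    (L : (config n -> R) -> config n -> R) : Prop :=
  forall (f : config n -> R) (eta : config n),
    (\sum_xi p h eta xi * f xi - f eta) / h @[h --> 0^'+] --> L f eta.

(* The Markov property is stated with an arbitrary finite list [past] of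
   pairs (time, state), multiplied out so that no conditioning on a null
   event occurs. *)
Definition markov_chain (n : nat) (d : measure_display) (T : measurableType d)
    (P : probability T R) (X : R -> {RV P >-> config n})
    (L : (config n -> R) -> config n -> R) (nu : config n -> R) : Prop :=
  (forall eta, P (X 0 @^-1` [set eta]) = (nu eta)%:E) /\
  exists p : R -> config n -> config n -> R,
    [/\ transition_function p, has_generator p L &
        forall (past : seq (R * config n)) (s t : R) (eta xi : config n),
          0 <= s -> s <= t -> (forall q, q \in past -> 0 <= q.1 <= s) ->
          let past_event :=
            [set w | forall q, q \in past -> X q.1 w = q.2]
              `&` X s @^-1` [set eta] in
          P (past_event `&` X t @^-1` [set xi]) =
            (P past_event * (p (t - s) eta xi)%:E)%E].

Definition bernoulli_product (n : nat) (u : lattice n -> R)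
    (eta : config n) : R :=
  \prod_x ((eta x)%:R * u x + (1 - (eta x)%:R) * (1 - u x)).

(* The difference quotient is taken inside [0, 1], hence one-sided at the end
   points; the values of u off [0, 1] are irrelevant. *)
Definition derivative01 (u : R -> R) (x l : R) : Prop :=
  (u y - u x) / (y - x) @[y --> within `[0, 1] x^'] --> l.

Definition profile_class (rho eps0 kappa : R) (u : R -> R) : Prop :=
  [/\ forall x, 0 <= x <= 1 -> 0 <= u x <= 1,
      forall x, 0 <= x <= 1 -> eps0 <= u x <= 1 - eps0,
      u 0 = rho, u 1 = rho &
      forall x, 0 <= x <= 1 ->
        exists2 l, derivative01 u x l & `|l| <= kappa].

Definition initial_law (n : nat) (u0 : R -> R) : config n -> R :=
  bernoulli_product (fun x => u0 ((site x)%:R / n%:R)).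

Section Laws.
Variables (n : nat) (d : measure_display) (T : measurableType d).
Variables (P : probability T R) (X : R -> {RV P >-> config n}).

Definition law (t : R) (eta : config n) : R :=
  fine (distribution P (X t) [set eta]).

Definition mean_density (t : R) (x : lattice n) : R :=
  fine ('E_P[fun w => (X t w x)%:R : R]).

Definition reference_law (t : R) : config n -> R :=
  bernoulli_product (mean_density t).
End Laws.

(* Radon-Nikodym derivative of mu with respect to nu, both measures on the
   finite set [config n] being given by their masses at points; see [rnderivE].
   Where nu vanishes the value is 0, by the convention x / 0 = 0. *)
Definition rnderiv (n : nat) (mu nu : config n -> R) (eta : config n) : R :=
  mu eta / nu eta.

Lemma rnderivE (n : nat) (mu nu : config n -> R) (A : {set config n}) :
  (forall eta, nu eta = 0 -> mu eta = 0) ->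
  \sum_(eta in A) mu eta = \sum_(eta in A) rnderiv mu nu eta * nu eta.
Proof.
move=> munu; apply: eq_bigr => eta _; rewrite /rnderiv.
by have [/[dup] /munu -> ->|nu0] := eqVneq (nu eta) 0; rewrite ?mulr0 ?divfK.
Qed.

(* The convention 0 log 0 = 0 is built in, since ln 0 = 0. *)
Definition relative_entropy (n : nat) (nu f : config n -> R) : R :=
  \sum_eta nu eta * (f eta * ln (f eta)).

End Exclusion.

(* Main.v *)
Require Import Defs.
From mathcomp Require Import ring lra zify.

(* The entropy is bounded by the chi-square distance G - 1, where G is the
   integral of f^2 and f is the density of the law with respect to nu, the
   product measure with the density u of the chain.  Differentiating,
     G' = - DD(f) - n^2 sum_x (u(x+1) - u(x))^2 E[w(x) w(x+1) f^2],
   with DD the Dirichlet form and w(x) = (eta(x) - u(x)) / (u(x) (1 - u(x))),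
   since the reference measure follows the evolution up to that quadratic form.

   The form enters with the favourable sign.  Transporting w(x) and w(x+1) to
   other points of a window of size c n costs a small multiple of DD, and the
   average over pairs of points of the window is a square, up to its diagonal.
   The transport error contains fields Q = sum_y q(y) w(y); integrating by parts
   in one factor of Q^2 bounds E[Q^2 f^2] by |q|^2 (E[f^2] + sum_x E[(D_x f)^2]),
   so that no concentration inequality is needed.  Since DD controls the sum of
   the one-site energies (carry a site to the reservoir by exchanges), hence
   G - 1 by Efron-Stein, there results
     G' <= - delta (G - 1) + C a G,   a = n sum_x (u(x+1) - u(x))^2.
   The maximum principle keeps u away from 0 and 1 and |n grad u| below kappa.
   As a is dominated by the decay rate of the energy n^-1 sum_x (u(x) - rho)^2,
   the function (1 + e^(delta t) (G - 1)) exp(C n^-1 e^(delta t) sum (u - rho)^2)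
   is nonincreasing in time. *)

(** The chi-square distance is used because the argument closes in it: integrating by parts against
    f^2 produces f times a gradient of f, which Young's inequality splits into Dirichlet energy and
    f^2 itself.

    The obstacle is the size of the quadratic form. Its coefficients n^2 (u(x+1) - u(x))^2 are
    merely bounded by kappa^2, and bounding w(x) w(x+1) pointwise gives n a G, a factor n too much.
    The sign supplies that factor: averaged over the pairs of a window of m sites, -w w is at most a
    constant over m. Hence m must be proportional to n. The diagonal then costs n / m and transport
    costs (m / n) DD, so m / n is a small constant, fixed by the requirement that DD absorb the
    transport.

    The factor a has to survive in the error C a G, since a bare constant would exclude decay. It
    survives because the squared transport coefficients sum to a quantity linear in a. Near time 0
    the error may exceed the spectral gap, but the time integral of e^(delta t) a is bounded
    uniformly in n. *)

Set Implicit Arguments.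
Unset Strict Implicit.
Unset Printing Implicit Defensive.

(** * Product measures *)

Section Bernoulli.
Variables (R : realType) (n : nat).
Implicit Types (u : lattice n -> R) (eta : config n) (f g phi psi : config n -> R).
Implicit Types (x y : lattice n) (a b : bool).

Definition upd eta x b : config n := [ffun z => if z == x then b else eta z].

Lemma updE eta x b z : upd eta x b z = if z == x then b else eta z.
Proof. by rewrite ffunE. Qed.

Lemma upd_same eta x b : upd eta x b x = b.
Proof. by rewrite updE eqxx. Qed.

Lemma upd_other eta x y b : y != x -> upd eta x b y = eta y.
Proof. by move=> yx; rewrite updE (negbTE yx). Qed.

Lemma upd_id eta x : upd eta x (eta x) = eta.
Proof. by apply/ffunP => z; rewrite updE; case: eqP => [->|]. Qed.

Lemma upd_upd eta x a b : upd (upd eta x a) x b = upd eta x b.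
Proof. by apply/ffunP => z; rewrite !updE; case: eqP. Qed.

Lemma updC eta x y a b : x != y ->
  upd (upd eta x a) y b = upd (upd eta y b) x a.
Proof.
move=> xy; apply/ffunP => z; rewrite !updE.
by case: (eqVneq z y) => [->|//]; rewrite eq_sym (negbTE xy).
Qed.

Lemma flip_upd eta x : flip eta x = upd eta x (~~ eta x).
Proof. by apply/ffunP => z; rewrite !ffunE; case: eqP => [->|]. Qed.

Lemma flipK x : involutive (fun eta => flip eta x).
Proof.
move=> eta; apply/ffunP => z; rewrite !ffunE.
by case: eqP => // _; rewrite negbK.
Qed.

Lemma exchange_upd eta x y a b : x != y ->
  exchange (upd (upd eta x a) y b) x y = upd (upd eta x b) y a.
Proof.
move=> xy; apply/ffunP => z; rewrite !ffunE.
case: tpermP => [->|->|/eqP zx /eqP zy].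
- by rewrite !eqxx (negbTE xy).
- by rewrite !eqxx (negbTE xy).
- by rewrite (negbTE zx) (negbTE zy).
Qed.

Definition expect u phi := \sum_eta bernoulli_product u eta * phi eta.

Definition site_grad x f eta := f (upd eta x true) - f (upd eta x false).

(** Normalised so that multiplication by [omega u x] is the adjoint of [site_grad x]; it is also the
    derivative of the log-likelihood in the parameter [u x]. *)
Definition omega u x eta := ((eta x)%:R - u x) / (u x * (1 - u x)).

Lemma expectD u f g : expect u (fun eta => f eta + g eta) = expect u f + expect u g.
Proof. by rewrite -big_split; apply: eq_bigr => eta _; rewrite mulrDr. Qed.

Lemma expectZ u c f : expect u (fun eta => c * f eta) = c * expect u f.
Proof. by rewrite big_distrr; apply: eq_bigr => eta _ /=; rewrite mulrCA. Qed.

Lemma expectB u f g : expect u (fun eta => f eta - g eta) = expect u f - expect u g.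
Proof. by rewrite -sumrB; apply: eq_bigr => eta _; rewrite mulrBr. Qed.

Lemma expectN u f : expect u (fun eta => - f eta) = - expect u f.
Proof. by rewrite -sumrN; apply: eq_bigr => eta _; rewrite mulrN. Qed.

Lemma expect_sum u (I : Type) (r : seq I) (P : pred I) (F : I -> config n -> R) :
  expect u (fun eta => \sum_(i <- r | P i) F i eta) =
  \sum_(i <- r | P i) expect u (F i).
Proof.
by rewrite exchange_big; apply: eq_bigr => eta _; rewrite big_distrr.
Qed.

Lemma eq_expect u f g : f =1 g -> expect u f = expect u g.
Proof. by move=> fg; apply: eq_bigr => eta _; rewrite fg. Qed.

Lemma expect_cst u c : expect u (fun=> c) = c.
Proof.
rewrite /expect -big_distrl /= -[RHS]mul1r; congr (_ * c).
rewrite /bernoulli_product.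
rewrite -(bigA_distr_bigA (fun x b => b%:R * u x + (1 - b%:R) * (1 - u x))).
by apply: big1 => x _; rewrite big_bool /=; ring.
Qed.

Lemma bernoulli_split u x eta :
  bernoulli_product u eta =
  ((eta x)%:R * u x + (1 - (eta x)%:R) * (1 - u x)) *
  \prod_(z | z != x) ((eta z)%:R * u z + (1 - (eta z)%:R) * (1 - u z)).
Proof. by rewrite /bernoulli_product (bigD1 x). Qed.

Lemma sum_site_true x (F : config n -> R) :
  \sum_eta F eta =
  \sum_(eta : config n | eta x) (F (upd eta x true) + F (upd eta x false)).
Proof.
rewrite (bigID (fun eta : config n => eta x)) /= big_split /=; congr (_ + _).
  by apply: eq_bigr => eta etax; rewrite -[in LHS](upd_id eta x) etax.
rewrite (reindex_inj (inv_inj (flipK x))) /=.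
rewrite (eq_bigl (fun eta : config n => eta x)); last first.
  by move=> eta; rewrite ffunE eqxx negbK.
by apply: eq_bigr => eta etax; rewrite flip_upd etax.
Qed.

(** The site [x] is resampled given all others. Rewriting both sides of an identity in this way
    reduces it to algebra in finitely many values of [phi]. *)
Lemma expect_site u x phi :
  expect u phi =
  expect u (fun eta =>
    u x * phi (upd eta x true) + (1 - u x) * phi (upd eta x false)).
Proof.
rewrite /expect !(sum_site_true x); apply: eq_bigr => eta _.
rewrite !(bernoulli_split _ x) !upd_same !upd_upd.
rewrite (eq_bigr (fun z => (eta z)%:R * u z + (1 - (eta z)%:R) * (1 - u z)));
  last by move=> z zx; rewrite upd_other.
rewrite [X in _ + _ * X * _ = _](eq_bigr (fun z => (eta z)%:R * u z + (1 - (eta z)%:R) * (1 - u z)));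
  last by move=> z zx; rewrite upd_other.
rewrite [X in _ = _ + _ * X * _](eq_bigr (fun z => (eta z)%:R * u z + (1 - (eta z)%:R) * (1 - u z)));
  last by move=> z zx; rewrite upd_other.
by rewrite /=; ring.
Qed.

Lemma expect_site2 u x y phi :
  expect u phi =
  expect u (fun eta =>
      u x * u y * phi (upd (upd eta x true) y true)
    + u x * (1 - u y) * phi (upd (upd eta x true) y false)
    + (1 - u x) * u y * phi (upd (upd eta x false) y true)
    + (1 - u x) * (1 - u y) * phi (upd (upd eta x false) y false)).
Proof.
rewrite (expect_site u y) (expect_site u x); apply: eq_expect => eta.
by ring.
Qed.

Section Interior.
Variables (u : lattice n -> R) (e : R).
Hypothesis e_gt0 : 0 < e.
Hypothesis u_int : forall x, e <= u x <= 1 - e.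

Let u_gt0 x : 0 < u x.
Proof. by have /andP[ex _] := u_int x; exact: lt_le_trans ex. Qed.

Let u_lt1 x : 0 < 1 - u x.
Proof. by have /andP[_ ex] := u_int x; move: e_gt0 ex; lra. Qed.

Lemma bernoulli_gt0 eta : 0 < bernoulli_product u eta.
Proof.
apply: prodr_gt0 => x _; have := u_gt0 x; have := u_lt1 x.
by case: (eta x); rewrite /= ?(subrr, subr0, mul0r, mul1r, addr0, add0r).
Qed.

Lemma ler_expect f g : (forall eta, f eta <= g eta) -> expect u f <= expect u g.
Proof.
move=> fg; apply: ler_sum => eta _.
by apply: ler_wpM2l => //; exact/ltW/bernoulli_gt0.
Qed.

Lemma expect_ge0 f : (forall eta, 0 <= f eta) -> 0 <= expect u f.
Proof.
by move=> f0; rewrite -(expect_cst u 0); exact: ler_expect.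
Qed.

Lemma expect_omega x phi :
  expect u (fun eta => omega u x eta * phi eta) = expect u (site_grad x phi).
Proof.
rewrite (expect_site u x); apply: eq_expect => eta.
rewrite /omega !upd_same /site_grad /=.
have := u_gt0 x; have := u_lt1 x => h1 h2.
by field; rewrite !gt_eqF.
Qed.

(** The prescribed value [b] has conditional probability at least [e], so forcing it costs at most a
    factor [1 / e]. *)
Lemma expect_upd_le x b phi : (forall eta, 0 <= phi eta) ->
  expect u (fun eta => phi (upd eta x b)) <= expect u phi / e.
Proof.
move=> phi0; rewrite ler_pdivlMr // mulrC -expectZ [leRHS](expect_site u x).
apply: ler_expect => eta; have /andP[h1 h2] := u_int x.
have p1 := phi0 (upd eta x true); have p0 := phi0 (upd eta x false).
by have := u_gt0 x; have := u_lt1 x; case: b; nra.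
Qed.

Lemma omega_abs x eta : `|omega u x eta| <= e^-1.
Proof.
rewrite /omega; have := u_gt0 x; have := u_lt1 x => h1 h2.
have /andP[h3 h4] := u_int x.
rewrite normrM normfV (gtr0_norm (mulr_gt0 h2 h1)) ler_pdivrMr ?mulr_gt0 //.
rewrite mulrC ler_pdivlMr //.
by case: (eta x); rewrite ?subr0 ?sub0r ?normrN /= gtr0_norm // ; nra.
Qed.

Lemma omega_sqr x eta : omega u x eta ^+ 2 <= e ^- 2.
Proof.
rewrite -real_normK ?num_real // -exprVn lerXn2r ?nnegrE ?invr_ge0 //.
- exact: ltW.
- exact: omega_abs.
Qed.

Lemma expect_upd2_le x y a b phi : (forall eta, 0 <= phi eta) ->
  expect u (fun eta => phi (upd (upd eta x a) y b)) <= expect u phi / e ^+ 2.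
Proof.
move=> phi0; rewrite expr2 invfM mulrA.
apply: le_trans (ler_wpM2r _ (expect_upd_le y b phi0)); last by rewrite invr_ge0 ltW.
by apply: (@expect_upd_le x a (fun eta => phi (upd eta y b))) => eta.
Qed.

Definition site_avg x f eta :=
  u x * f (upd eta x true) + (1 - u x) * f (upd eta x false).

Lemma expect_site_avg x f : expect u (site_avg x f) = expect u f.
Proof. by rewrite [RHS](expect_site u x). Qed.

(** The second moment of a two-point law is its squared mean plus its variance. *)
Lemma site_avg_sqr x f eta :
  site_avg x f eta ^+ 2 + u x * (1 - u x) * site_grad x f eta ^+ 2 =
  site_avg x (fun xi => f xi ^+ 2) eta.
Proof. by rewrite /site_avg /site_grad; ring. Qed.

Lemma site_grad_avg x y f eta :
  site_grad y (site_avg x f) eta =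
  if x == y then 0 else site_avg x (site_grad y f) eta.
Proof.
rewrite /site_grad /site_avg; case: (eqVneq x y) => [->|xy].
  by rewrite !upd_upd subrr.
by rewrite ![upd (upd eta y _) x _]updC 1?eq_sym //; ring.
Qed.

(** Averaging at [x] kills the gradient at [x]; at any other site it commutes with the gradient, and
    the variance identity makes it a contraction. *)
Lemma expect_site_grad_avg x y f :
  expect u (fun eta => site_grad y (site_avg x f) eta ^+ 2) <=
  expect u (fun eta => site_grad y f eta ^+ 2).
Proof.
rewrite [leRHS](expect_site u x); apply: ler_expect => eta.
rewrite site_grad_avg.
rewrite -[leRHS]/(site_avg x (fun xi => site_grad y f xi ^+ 2) eta).
rewrite -site_avg_sqr; case: ifP => _.
  by rewrite expr0n addr_ge0 ?sqr_ge0 // mulr_ge0 ?sqr_ge0 // mulr_ge0 ?ltW.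
by rewrite lerDl mulr_ge0 ?sqr_ge0 // mulr_ge0 ?ltW.
Qed.

Definition iter_avg (s : seq (lattice n)) f := foldr site_avg f s.

Lemma expect_iter_avg s f : expect u (iter_avg s f) = expect u f.
Proof. by elim: s => //= x s IH; rewrite expect_site_avg. Qed.

Lemma expect_site_grad_iter s y f :
  expect u (fun eta => site_grad y (iter_avg s f) eta ^+ 2) <=
  expect u (fun eta => site_grad y f eta ^+ 2).
Proof.
by elim: s => //= x s IH; exact: le_trans (expect_site_grad_avg _ _ _) IH.
Qed.

Lemma iter_avg_upd s f x b eta : x \in s ->
  iter_avg s f (upd eta x b) = iter_avg s f eta.
Proof.
elim: s eta => //= y s IH eta; rewrite inE.
case: (eqVneq x y) => [->|xy] /= xs; first by rewrite /site_avg !upd_upd.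
by rewrite /site_avg ![upd (upd eta x b) y _]updC // !IH.
Qed.

Lemma iter_avg_enum f eta : iter_avg (enum (lattice n)) f eta = expect u f.
Proof.
rewrite -(expect_iter_avg (enum (lattice n))).
rewrite -[LHS](expect_cst u); apply: eq_expect => xi.
set F := iter_avg _ f.
have F_upd x b zeta : F (upd zeta x b) = F zeta by rewrite /F iter_avg_upd ?mem_enum.
(* [mix s] agrees with [eta] on [s] and with [xi] elsewhere: [xi] is turned into [eta] one site at a
   time, without changing [F]. *)
pose mix (s : seq (lattice n)) : config n := foldr (fun x z => upd z x (eta x)) xi s.
have F_mix s : F (mix s) = F xi by elim: s => //= x s IH; rewrite F_upd.
rewrite -(F_mix (enum (lattice n))); congr F; apply/ffunP => z.
have : z \in enum (lattice n) by rewrite mem_enum.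
elim: (enum _) => //= x s IH; rewrite inE updE.
by case: (eqVneq z x) => [->|] //= _ /IH.
Qed.

(* Efron-Stein: average out the sites one at a time. *)
Lemma efron_stein f :
  expect u (fun eta => f eta ^+ 2) - expect u f ^+ 2 <=
  \sum_x expect u (fun eta => site_grad x f eta ^+ 2).
Proof.
have main s : expect u (fun eta => f eta ^+ 2) <=
    expect u (fun eta => iter_avg s f eta ^+ 2) +
    \sum_(x <- s) expect u (fun eta => site_grad x f eta ^+ 2).
  elim: s => [|x s IH] /=; first by rewrite big_nil addr0.
  apply: le_trans IH _; rewrite big_cons addrA lerD2r.
  rewrite (expect_site u x); apply: (@le_trans _ _ (expect u (fun eta =>
    site_avg x (iter_avg s f) eta ^+ 2 +  site_grad x (iter_avg s f) eta ^+ 2))).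
    apply: ler_expect => eta.
    rewrite -[leLHS]/(site_avg x (fun xi => iter_avg s f xi ^+ 2) eta).
    rewrite -site_avg_sqr lerD2l; rewrite -[leRHS]mul1r.
    apply: ler_wpM2r; first exact: sqr_ge0.
    by have := u_gt0 x; have := u_lt1 x; nra.
  by rewrite expectD lerD2l expect_site_grad_iter.
have := main (enum (lattice n)); rewrite big_enum /=.
rewrite [X in _ <= X + _](@eq_expect _ _ (fun=> expect u f ^+ 2)); last first.
  by move=> eta; rewrite iter_avg_enum.
by rewrite expect_cst => h; lra.
Qed.

End Interior.
End Bernoulli.

(** * Local integration by parts *)

Section Fields.
Variables (R : realType) (n : nat) (u : lattice n -> R) (e : R).
Implicit Types (eta : config n) (f g phi psi : config n -> R).
Implicit Types (x y : lattice n) (a b : bool).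
Hypothesis e_gt0 : 0 < e.
Hypothesis u_int : forall x, e <= u x <= 1 - e.

Let u_gt0 x : 0 < u x.
Proof. by have /andP[ex _] := u_int x; exact: lt_le_trans ex. Qed.

Let u_lt1 x : 0 < 1 - u x.
Proof. by have /andP[_ ex] := u_int x; move: e_gt0 ex; lra. Qed.

Definition site_sum x f eta := f (upd eta x true) + f (upd eta x false).

Definition pair_grad x y f eta :=
  f (upd (upd eta x true) y false) - f (upd (upd eta x false) y true).

Definition pair_sum x y f eta :=
  f (upd (upd eta x true) y false) + f (upd (upd eta x false) y true).

Definition site_energy f x := expect u (fun eta => site_grad x f eta ^+ 2).

Definition exchange_energy f x y :=
  expect u (fun eta => (f (exchange eta x y) - f eta) ^+ 2).

Lemma site_energy_ge0 f x : 0 <= site_energy f x.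
Proof. by apply: (expect_ge0 e_gt0 u_int) => eta; exact: sqr_ge0. Qed.

Lemma exchange_energy_ge0 f x y : 0 <= exchange_energy f x y.
Proof. by apply: (expect_ge0 e_gt0 u_int) => eta; exact: sqr_ge0. Qed.

Lemma omega_upd x y b eta : y != x -> omega u y (upd eta x b) = omega u y eta.
Proof. by move=> yx; rewrite /omega upd_other. Qed.

Lemma site_grad_sqrM x phi f eta :
  (forall xi b, phi (upd xi x b) = phi xi) ->
  site_grad x (fun xi => phi xi * f xi ^+ 2) eta =
  phi eta * (site_grad x f eta * site_sum x f eta).
Proof. by move=> phi_x; rewrite /site_grad /site_sum !phi_x; ring. Qed.

Lemma expect_site_sum_sqr x phi f :
  (forall xi b, phi (upd xi x b) = phi xi) -> (forall xi, 0 <= phi xi) ->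
  expect u (fun eta => phi eta * site_sum x f eta ^+ 2) <=
  4 / e * expect u (fun eta => phi eta * f eta ^+ 2).
Proof.
move=> phi_x phi0.
set psi := fun eta => phi eta * f eta ^+ 2.
have psi0 eta : 0 <= psi eta by rewrite mulr_ge0 ?sqr_ge0.
apply: (@le_trans _ _ (expect u (fun eta =>
   2 * (psi (upd eta x true) + psi (upd eta x false))))).
  apply: (ler_expect e_gt0 u_int) => eta; rewrite /psi !phi_x /site_sum.
  set p := f _; set q := f _; rewrite -subr_ge0.
  rewrite (_ : _ - _ = phi eta * (p - q) ^+ 2); last by ring.
  by rewrite mulr_ge0 ?sqr_ge0.
rewrite expectZ expectD.
have := expect_upd_le e_gt0 u_int x true psi0.
have := expect_upd_le e_gt0 u_int x false psi0.
by lra.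
Qed.

Lemma expect_pair_sum_sqr x y phi f : x != y ->
  (forall xi b, phi (upd xi x b) = phi xi) ->
  (forall xi b, phi (upd xi y b) = phi xi) -> (forall xi, 0 <= phi xi) ->
  expect u (fun eta => phi eta * pair_sum x y f eta ^+ 2) <=
  4 / e ^+ 2 * expect u (fun eta => phi eta * f eta ^+ 2).
Proof.
move=> xy phi_x phi_y phi0.
set psi := fun eta => phi eta * f eta ^+ 2.
have psi0 eta : 0 <= psi eta by rewrite mulr_ge0 ?sqr_ge0.
apply: (@le_trans _ _ (expect u (fun eta =>
   2 * (psi (upd (upd eta x true) y false) + psi (upd (upd eta x false) y true))))).
  apply: (ler_expect e_gt0 u_int) => eta; rewrite /psi !(phi_x, phi_y) /pair_sum.
  set p := f _; set q := f _; rewrite -subr_ge0.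
  rewrite (_ : _ - _ = phi eta * (p - q) ^+ 2); last by ring.
  by rewrite mulr_ge0 ?sqr_ge0.
rewrite expectZ expectD.
have := expect_upd2_le e_gt0 u_int x y true false psi0.
have := expect_upd2_le e_gt0 u_int x y false true psi0.
by lra.
Qed.

Lemma upd2_upd2 eta x y a b c d : x != y ->
  upd (upd (upd (upd eta x a) y b) x c) y d = upd (upd eta x c) y d.
Proof.
by move=> xy; rewrite [upd (upd _ y b) x c]updC 1?eq_sym // !upd_upd.
Qed.

(** A difference of two fields is the adjoint of the exchange gradient up to a correction, present
    because the product measure is not invariant under exchanges. The correction is small with
    [u y - u x]. *)
Lemma expect_omegaB x y phi : x != y ->
  expect u (fun eta => (omega u x eta - omega u y eta) * phi eta) =
  expect u (pair_grad x y phi) +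
  (u y - u x) * expect u (fun eta => omega u x eta * omega u y eta * phi eta).
Proof.
move=> xy; rewrite -expectZ -expectD.
rewrite [LHS](expect_site2 u x y) [RHS](expect_site2 u x y).
apply: eq_expect => eta; rewrite /pair_grad /omega.
rewrite !upd2_upd2 // !upd_same ![upd (upd eta x _) y _ x]upd_other // !upd_same /=.
have hx := u_gt0 x; have hy := u_gt0 y; have kx := u_lt1 x; have ky := u_lt1 y.
by field; rewrite !gt_eqF.
Qed.

Lemma expect_exchangeB x y phi : x != y ->
  expect u (fun eta => phi (exchange eta x y) - phi eta) =
  (u y - u x) * expect u (pair_grad x y phi).
Proof.
move=> xy; rewrite -expectZ (expect_site2 u x y).
rewrite [RHS](expect_site2 u x y).
apply: eq_expect => eta; rewrite !exchange_upd // /pair_grad.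
by rewrite !upd2_upd2 //; ring.
Qed.

(** The exchange energy sees only configurations with different occupations at [x] and [y], an event
    of probability at least [e]. *)
Lemma pair_grad_energy x y f : x != y ->
  expect u (fun eta => pair_grad x y f eta ^+ 2) <= exchange_energy f x y / e.
Proof.
move=> xy; rewrite ler_pdivlMr // mulrC -expectZ /exchange_energy.
rewrite [leRHS](expect_site2 u x y); apply: (ler_expect e_gt0 u_int) => eta.
rewrite !exchange_upd // /pair_grad.
set p := f (upd (upd eta x true) y true).
set q := f (upd (upd eta x true) y false).
set r := f (upd (upd eta x false) y true).
set s := f (upd (upd eta x false) y false).
have /andP[hx kx] := u_int x; have /andP[hy ky] := u_int y.
have := sqr_ge0 (q - r) => h.
suff : e <= u x * (1 - u y) + (1 - u x) * u y.
  by move=> /(ler_wpM2r h); nra.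
have := u_gt0 y; have := u_lt1 y; nra.
Qed.

(** A flip at [x] is an exchange of [x] and [y] followed by a flip at [y]. The spectator value is
    then at [x] instead of [y], so the weight [u y] must be compared with [u x], at the cost of the
    factor [1 + k / e]. *)
Lemma site_energy_step x y f (c k : R) : x != y -> 0 < c -> `|u y - u x| <= k ->
  site_energy f x <= (1 + c) / e * exchange_energy f x y +
    (1 + c^-1) * (1 + k / e) * site_energy f y.
Proof.
move=> xy c0 hk; have yx : y != x by rewrite eq_sym.
pose F a b eta := f (upd (upd eta x a) y b).
have Ex : site_energy f x = expect u (fun eta =>
    u y * (F true true eta - F false true eta) ^+ 2 +
    (1 - u y) * (F true false eta - F false false eta) ^+ 2).
  rewrite /site_energy (expect_site u y); apply: eq_expect => eta.
  by rewrite /site_grad ![upd (upd eta y _) x _]updC.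
have Ey : site_energy f y = expect u (fun eta =>
    u x * (F true true eta - F true false eta) ^+ 2 +
    (1 - u x) * (F false true eta - F false false eta) ^+ 2).
  by rewrite /site_energy (expect_site u x).
apply: (@le_trans _ _ ((1 + c) * expect u (fun eta => pair_grad x y f eta ^+ 2) +
    (1 + c^-1) * (1 + k / e) * site_energy f y)); last first.
  rewrite lerD2r -[(1 + c) / e * _]mulrA; apply: ler_wpM2l; first lra.
  by rewrite mulrC pair_grad_energy.
have cV0 : 0 < c^-1 by rewrite invr_gt0.
rewrite Ex Ey -!expectZ -expectD; apply: (ler_expect e_gt0 u_int) => eta.
rewrite -[pair_grad x y f eta]/(F true false eta - F false true eta).
set p := F true true eta; set q := F true false eta.
set r := F false true eta; set s := F false false eta.
have young (A B : R) : (A + B) ^+ 2 <= (1 + c) * A ^+ 2 + (1 + c^-1) * B ^+ 2.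
  rewrite -subr_ge0 (_ : _ - _ = c^-1 * (c * A - B) ^+ 2).
    by rewrite mulr_ge0 ?sqr_ge0 // ltW.
  by field; rewrite gt_eqF.
have h1 := young (q - r) (p - q); have h0 := young (q - r) (r - s).
rewrite [q - r + (p - q)]addrC addrA subrK in h1.
rewrite addrA subrK in h0.
have /andP[hx kx] := u_int x; have /andP[hy ky] := u_int y.
have ke : k <= k / e * u x.
  by rewrite mulrAC ler_pdivlMr // ler_wpM2l // (le_trans _ hk).
have ke' : k <= k / e * (1 - u x).
  by rewrite mulrAC ler_pdivlMr // ler_wpM2l ?(le_trans _ hk) //; lra.
move: hk; rewrite ler_norml => /andP[hk1 hk2].
have vu : u y <= (1 + k / e) * u x by rewrite mulrDl mul1r; lra.
have vu' : 1 - u y <= (1 + k / e) * (1 - u x) by rewrite mulrDl mul1r; lra.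
have k1 := ler_wpM2l (ltW (u_gt0 y)) h1.
have k0 := ler_wpM2l (ltW (u_lt1 y)) h0.
have cc : 0 <= 1 + c^-1 by lra.
have k2 := ler_wpM2r (mulr_ge0 cc (sqr_ge0 (p - q))) vu.
have k3 := ler_wpM2r (mulr_ge0 cc (sqr_ge0 (r - s))) vu'.
set KE := k / e in k2 k3 *; set C := c^-1 in k0 k1 k2 k3 *.
lra.
Qed.

Lemma absM_young (s A B : R) : 0 < s -> `|A * B| <= s * A ^+ 2 + (4 * s)^-1 * B ^+ 2.
Proof.
move=> s0; rewrite ler_norml; apply/andP; split; rewrite -subr_ge0.
  rewrite (_ : _ - _ = s * (A + (2 * s)^-1 * B) ^+ 2).
    by rewrite mulr_ge0 ?sqr_ge0 // ltW.
  by field; rewrite gt_eqF.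
rewrite (_ : _ - _ = s * (A - (2 * s)^-1 * B) ^+ 2).
  by rewrite mulr_ge0 ?sqr_ge0 // ltW.
by field; rewrite gt_eqF.
Qed.

Lemma expect_abs_le f g : (forall eta, `|f eta| <= g eta) ->
  `|expect u f| <= expect u g.
Proof.
move=> fg; rewrite ler_norml -expectN; apply/andP; split;
  apply: (ler_expect e_gt0 u_int) => eta; have := fg eta; rewrite ler_norml;
  by case/andP.
Qed.

Lemma expect_sqrM_ge0 f g : 0 <= expect u (fun eta => g eta ^+ 2 * f eta ^+ 2).
Proof. by apply: (expect_ge0 e_gt0 u_int) => eta; rewrite mulr_ge0 ?sqr_ge0. Qed.

(** As [Q] ignores the site [x], the gradient falls on [f ^ 2] alone and factors into [site_grad]
    times [site_sum], to which Young's inequality applies. *)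
Lemma expect_omega_form x Q f (s : R) : 0 < s ->
  (forall eta b, Q (upd eta x b) = Q eta) ->
  `|expect u (fun eta => omega u x eta * (Q eta * f eta ^+ 2))| <=
  s * site_energy f x + (s * e)^-1 * expect u (fun eta => Q eta ^+ 2 * f eta ^+ 2).
Proof.
move=> s0 Qx; rewrite (expect_omega e_gt0 u_int).
rewrite (eq_expect _ (fun eta => site_grad_sqrM f eta Qx)).
apply: (@le_trans _ _ (expect u (fun eta => s * site_grad x f eta ^+ 2 +
    (4 * s)^-1 * (Q eta ^+ 2 * site_sum x f eta ^+ 2)))).
  by apply: expect_abs_le => eta; rewrite mulrCA -exprMn absM_young.
rewrite expectD !expectZ lerD2l.
have Q2 xi b : Q (upd xi x b) ^+ 2 = Q xi ^+ 2 by rewrite Qx.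
have h := expect_site_sum_sqr f Q2 (fun xi => sqr_ge0 _).
have s4 : 0 <= (4 * s)^-1 by rewrite invr_ge0; lra.
apply: le_trans (ler_wpM2l s4 h) _.
rewrite mulrA le_eqVlt; apply/orP; left; apply/eqP; congr (_ * _).
by field; rewrite !gt_eqF.
Qed.

Lemma expect_bond_form x y Q f (b s k : R) : x != y -> 0 < b -> 0 < s ->
  `|u y - u x| <= k ->
  (forall eta c, Q (upd eta x c) = Q eta) ->
  (forall eta c, Q (upd eta y c) = Q eta) ->
  `|expect u (fun eta => (omega u x eta - omega u y eta) * (Q eta * f eta ^+ 2))| <=
  b / e * exchange_energy f x y + k * s * site_energy f x +
  ((b * e ^+ 2)^-1 + k * (s * e ^+ 3)^-1) * expect u (fun eta => Q eta ^+ 2 * f eta ^+ 2).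
Proof.
move=> xy b0 s0 hk Qx Qy; have yx : y != x by rewrite eq_sym.
rewrite expect_omegaB //; set V := expect u (fun eta => Q eta ^+ 2 * _).
have V0 : 0 <= V by exact: expect_sqrM_ge0.
apply: le_trans (ler_normD _ _) _.
rewrite [_ * V]mulrDl [X in _ <= X](_ : _ = (b / e * exchange_energy f x y + (b * e ^+ 2)^-1 * V) +
  (k * s * site_energy f x + k / (s * e ^+ 3) * V)); last by ring.
apply: lerD.
  apply: (@le_trans _ _ (expect u (fun eta => b * pair_grad x y f eta ^+ 2 +
      (4 * b)^-1 * (Q eta ^+ 2 * pair_sum x y f eta ^+ 2)))).
    apply: expect_abs_le => eta.
    rewrite (_ : pair_grad _ _ _ _ = pair_grad x y f eta * (Q eta * pair_sum x y f eta)).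
      by rewrite -exprMn absM_young.
    by rewrite /pair_grad /pair_sum !(Qx, Qy); ring.
  rewrite expectD !expectZ; apply: lerD.
    by rewrite -mulrA ler_wpM2l ?(ltW b0) // mulrC pair_grad_energy.
  have Q2x xi c : Q (upd xi x c) ^+ 2 = Q xi ^+ 2 by rewrite Qx.
  have Q2y xi c : Q (upd xi y c) ^+ 2 = Q xi ^+ 2 by rewrite Qy.
  have h := expect_pair_sum_sqr f xy Q2x Q2y (fun xi => sqr_ge0 _).
  have b4 : 0 <= (4 * b)^-1 by rewrite invr_ge0; lra.
  apply: le_trans (ler_wpM2l b4 h) _.
  rewrite mulrA le_eqVlt; apply/orP; left; apply/eqP; congr (_ * _).
  by field; rewrite !gt_eqF.
rewrite normrM -mulrA -[k / _ * V]mulrA -mulrDr.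
apply: ler_pM => //.
(* The correction is again a one-site form at [x]: the second factor [omega u y] ignores [x] and
   joins the field, at the cost [e ^- 2] in its square. *)
pose Q' eta := omega u y eta * Q eta.
rewrite (@eq_expect _ _ _ _ (fun eta => omega u x eta * (Q' eta * f eta ^+ 2))); last first.
  by move=> eta; rewrite /Q' !mulrA.
have Q'x eta c : Q' (upd eta x c) = Q' eta by rewrite /Q' omega_upd // Qx.
apply: le_trans (expect_omega_form f s0 Q'x) _; rewrite lerD2l.
apply: (@le_trans _ _ ((s * e)^-1 * (e ^- 2 * V))).
  apply: ler_wpM2l; first by rewrite invr_ge0 mulr_ge0 // ltW.
  rewrite -expectZ; apply: (ler_expect e_gt0 u_int) => eta.
  rewrite /Q' exprMn -mulrA; apply: ler_wpM2r.
    by rewrite mulr_ge0 ?sqr_ge0.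
  exact: omega_sqr e_gt0 u_int _ _.
rewrite mulrA le_eqVlt; apply/orP; left; apply/eqP; congr (_ * _).
by field; rewrite !gt_eqF.
Qed.

(* The field [Q] is integrated by parts in one factor only, so that its second
   moment is controlled by the energy without any concentration bound. *)
Lemma expect_linear_sqr (q : lattice n -> R) f :
  expect u (fun eta => (\sum_y q y * omega u y eta) ^+ 2 * f eta ^+ 2) <=
  (\sum_y q y ^+ 2) *
    (3 / e ^+ 2 * expect u (fun eta => f eta ^+ 2) + 32 / e ^+ 2 * \sum_x site_energy f x).
Proof.
pose Q eta := \sum_y q y * omega u y eta.
rewrite -[leLHS]/(expect u (fun eta => Q eta ^+ 2 * f eta ^+ 2)).
set W := \sum_y q y ^+ 2; set V := expect u (fun eta => f eta ^+ 2).
set B := expect u _; set S := \sum_x _.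
have V0 : 0 <= V by apply: (expect_ge0 e_gt0 u_int) => eta; exact: sqr_ge0.
have B0 : 0 <= B by exact: expect_sqrM_ge0.
have S0 : 0 <= S by apply: sumr_ge0 => x _; exact: site_energy_ge0.
have W0 : 0 <= W by apply: sumr_ge0 => x _; exact: sqr_ge0.
(* The Young parameter chosen below has [W] as a factor, so the zero field is treated apart. *)
have [W00|Wn0] := eqVneq W 0.
  rewrite W00 mul0r /B (eq_expect _ (_ : _ =1 fun=> 0)) ?expect_cst // => eta.
  rewrite /Q big1 ?expr0n ?mul0r // => y _.
  have /eqP := W00; rewrite psumr_eq0; last by move=> z _; exact: sqr_ge0.
  by move=> /allP/(_ y); rewrite mem_index_enum sqrf_eq0 => /(_ isT) /eqP ->; rewrite mul0r.
have Wgt0 : 0 < W by rewrite lt_def Wn0.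
have term y : expect u (fun eta => q y * omega u y eta * (Q eta * f eta ^+ 2)) <=
    q y ^+ 2 * (e ^- 2 * V + (4 * W)^-1 * (B + W * e ^- 2 * V)) + 8 * W / e ^+ 2 * site_energy f y.
  (* Without its own term the field ignores the site [y]; the removed diagonal term is bounded
     pointwise. *)
  pose Qy eta := Q eta - q y * omega u y eta.
  have Qy_upd eta b : Qy (upd eta y b) = Qy eta.
    rewrite /Qy /Q (bigD1 y) //= [in RHS](bigD1 y) //= ![_ + _ - _]addrAC !subrr !add0r.
    by apply: eq_bigr => z zy; rewrite omega_upd.
  rewrite (@eq_expect _ _ _ _ (fun eta => q y ^+ 2 * (omega u y eta ^+ 2 * f eta ^+ 2) +
     q y * (omega u y eta * (Qy eta * f eta ^+ 2)))); last by move=> eta; rewrite /Qy; ring.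
  rewrite expectD !expectZ mulrDr -addrA; apply: lerD.
    apply: ler_wpM2l; first exact: sqr_ge0.
    rewrite -expectZ; apply: (ler_expect e_gt0 u_int) => eta.
    by apply: ler_wpM2r; [exact: sqr_ge0 | exact: omega_sqr].
  apply: le_trans (ler_norm _) _.
  have [->|qy] := eqVneq (q y) 0.
    rewrite mul0r normr0 expr0n mul0r add0r !mulr_ge0 ?invr_ge0 ?exprn_ge0 ?(ltW e_gt0) //.
    exact: site_energy_ge0.
  have nq : 0 < `|q y| by rewrite normr_gt0.
  (* With this parameter the multiples of [B] on the right sum to at most [B / 4], which the left
     side absorbs. *)
  have s0 : 0 < 8 * W / (e ^+ 2 * `|q y|).
    by rewrite divr_gt0 ?mulr_gt0 ?exprn_gt0 //.
  rewrite normrM; apply: le_trans (ler_wpM2l (normr_ge0 _) (expect_omega_form f s0 Qy_upd)) _.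
  have hB : expect u (fun eta => Qy eta ^+ 2 * f eta ^+ 2) <= 2 * B + 2 * W * e ^- 2 * V.
    apply: (@le_trans _ _ (expect u (fun eta => 2 * (Q eta ^+ 2 * f eta ^+ 2) +
       (2 * W * e ^- 2) * f eta ^+ 2))); last by rewrite expectD !expectZ.
    apply: (ler_expect e_gt0 u_int) => eta; rewrite mulrA -mulrDl.
    apply: ler_wpM2r; first exact: sqr_ge0.
    apply: (@le_trans _ _ (2 * Q eta ^+ 2 + 2 * (q y * omega u y eta) ^+ 2)).
      by rewrite /Qy; have := sqr_ge0 (Q eta + q y * omega u y eta); nra.
    rewrite lerD2l -mulrA ler_wpM2l // exprMn ler_pM ?sqr_ge0 //.
      by rewrite /W (bigD1 y) //= lerDl sumr_ge0 // => z _; exact: sqr_ge0.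
    exact: omega_sqr.
  rewrite mulrDr addrC; apply: lerD.
    rewrite mulrA le_eqVlt; apply/orP; left; apply/eqP; congr (_ * _).
    by field; rewrite !gt_eqF.
  apply: (@le_trans _ _ (`|q y| * ((8 * W / (e ^+ 2 * `|q y|) * e)^-1 * (2 * B + 2 * W * e ^- 2 * V)))).
    apply: ler_wpM2l => //; apply: ler_wpM2l => //.
    by rewrite invr_ge0 mulr_ge0 // ltW.
  rewrite -[q y ^+ 2]real_normK ?num_real //.
  rewrite [X in X <= _](_ : _ = e * (`|q y| ^+ 2 * ((4 * W)^-1 * (B + W * e ^- 2 * V)))); last first.
    by field; rewrite !gt_eqF.
  rewrite -[leRHS]mul1r; apply: ler_wpM2r.
    rewrite !mulr_ge0 ?invr_ge0 ?addr_ge0 ?mulr_ge0 ?invr_ge0 ?exprn_ge0 ?(ltW e_gt0) //.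
  by have := u_int y; case/andP; have := e_gt0; lra.
have EB : B = \sum_y expect u (fun eta => q y * omega u y eta * (Q eta * f eta ^+ 2)).
  rewrite -expect_sum; apply: eq_expect => eta.
  by rewrite -big_distrl /= expr2 -mulrA.
have := ler_sum (index_enum (lattice n)) (fun y (_ : true) => term y).
rewrite -EB big_split /= -big_distrl -big_distrr /= -/W -/S => h.
rewrite [leRHS](_ : _ = 5 / 4 * (W / e ^+ 2 * V) + B / 4 + 8 * (W / e ^+ 2 * S)) in h;
  last by field; rewrite !gt_eqF.
rewrite [leRHS](_ : _ = 3 * (W / e ^+ 2 * V) + 32 * (W / e ^+ 2 * S));
  last by field; rewrite !gt_eqF.
have We : 0 <= W / e ^+ 2 by rewrite divr_ge0 ?exprn_ge0 // ltW.
have := mulr_ge0 We V0; have := mulr_ge0 We S0.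
move: h; set p := _ * V; set r := _ * S; clearbody p r B; lra.
Qed.

End Fields.

(** * Transport of a pair along the lattice *)

Section Windows.
Variable R : realType.
Implicit Types (w a v : nat -> R).

Lemma sum_eq_pick w N (c : nat) : (forall k, (N <= k)%N -> w k = 0) ->
  \sum_(z < N) (c == z :> nat)%:R * w z = w c.
Proof.
move=> w0; case: (ltnP c N) => cN.
  rewrite (bigD1 (Ordinal cN)) //= eqxx mul1r big1 ?addr0 // => z /eqP zc.
  rewrite (_ : (c == z :> nat) = false) ?mul0r //; apply/eqP => cz; apply: zc.
  by apply/val_inj.
rewrite w0 // big1 // => z _; rewrite (_ : (c == z :> nat) = false) ?mul0r //.
by apply/eqP => cz; move: cN; rewrite cz leqNgt ltn_ord.
Qed.

Lemma sum_eq_le1 N (c : nat) : \sum_(z < N) (c == z :> nat)%:R <= 1 :> R.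
Proof.
case: (ltnP c N) => cN.
  rewrite (bigD1 (Ordinal cN)) //= eqxx big1 ?addr0 // => z /eqP zc.
  rewrite (_ : (c == z :> nat) = false) //; apply/eqP => cz; apply: zc.
  by apply/val_inj.
rewrite big1 ?ler01 // => z _; rewrite (_ : (c == z :> nat) = false) //.
by apply/eqP => cz; move: cN; rewrite cz leqNgt ltn_ord.
Qed.

Lemma sum_window_le N p j : \sum_(z < N) (p <= z < p + j)%N%:R <= j%:R :> R.
Proof.
elim: j => [|j IH].
  by rewrite big1 // => z _; rewrite (_ : (_ && _) = false) //; lia.
rewrite -natr1; apply: (@le_trans _ _ (\sum_(z < N) ((p <= z < p + j)%N%:R + (p + j == z)%N%:R))).
  apply: ler_sum => z _; rewrite -natrD ler_nat; lia.
by rewrite big_split lerD ?sum_eq_le1.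
Qed.

(** The window may stick out of the lattice: since [w] vanishes beyond [M], nothing is lost when the
    sum stops there. *)
Lemma telescope_window w M (p q : nat) : (forall k, (M < k)%N -> w k = 0) -> (p <= q)%N ->
  \sum_(z < M.+1) (p <= z < q)%N%:R * (w z - w z.+1) = w p - w q.
Proof.
move=> w0; elim: q => [|q IH].
  rewrite leqn0 => /eqP ->; rewrite subrr big1 // => z _.
  by rewrite (_ : (_ && _) = false) ?mul0r //; lia.
rewrite leq_eqVlt => /orP[/eqP ->|pq].
  rewrite subrr big1 // => z _.
  by rewrite (_ : (_ && _) = false) ?mul0r //; lia.
rewrite (eq_bigr (fun z : 'I_M.+1 => (p <= z < q)%N%:R * (w z - w z.+1) +
  (q == z :> nat)%:R * (w z - w z.+1))); last first.
  move=> z _; rewrite -mulrDl -natrD; congr (_%:R * _); lia.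
rewrite big_split /= IH; last by lia.
rewrite (@sum_eq_pick (fun z => w z - w z.+1)); first by ring.
by move=> k kM; rewrite !w0 ?subrr //; lia.
Qed.

(** The square being nonnegative, the sum over pairs is at least minus half of the diagonal; this is
    where the sign of the quadratic form is used. *)
Lemma pair_sum_square v m :
  2 * (\sum_(j < m) \sum_(i < j) v i * v j) =
  (\sum_(j < m) v j) ^+ 2 - \sum_(j < m) v j ^+ 2.
Proof.
elim: m => [|m IH]; first by rewrite !big_ord0 expr0n mulr0 subr0.
by rewrite !big_ord_recr /= mulrDr IH -big_distrl /=; ring.
Qed.

Lemma sum_pairs_cst m (c : R) :
  \sum_(j < m.+1) \sum_(i < j) c = c * (m%:R * m.+1%:R / 2).
Proof.
elim: m => [|m IH]; first by rewrite big_ord1 big_ord0 !(mul0r, mulr0).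
rewrite big_ord_recr /= IH sumr_const card_ord -[c *+ _]mulr_natr.
by rewrite -!natr1; field.
Qed.

(* When the points [x], [x.+1] of a product [w x * w x.+1] are carried to [x + i]
   and [x + j], the second point moving first, [flow_coef a M i j z y] is the
   coefficient of [w y] in the field multiplying the gradient [w z - w z.+1]. *)
Definition flow_coef a M i j (z y : nat) : R :=
  \sum_(x < M) a x *
    (((x == y :> nat) && (x < z < x + j)%N)%:R +
     ((x + j == y)%N && (x <= z < x + i)%N)%:R).

(** The difference of products is [w x * (w x.+1 - w (x + j)) + w (x + j) * (w x - w (x + i))], and
    both brackets telescope. *)
Lemma flow_decomposition w a M i j : (forall k, (M < k)%N -> w k = 0) -> (0 < j)%N ->
  \sum_(x < M) a x * (w x * w x.+1 - w (x + i)%N * w (x + j)%N) =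
  \sum_(z < M.+1) (w z - w z.+1) * \sum_(y < M.+1) flow_coef a M i j z y * w y.
Proof.
move=> w0 j0.
have E (z : 'I_M.+1) : (w z - w z.+1) * \sum_(y < M.+1) flow_coef a M i j z y * w y =
    \sum_(x < M) a x * ((x.+1 <= z < x + j)%N%:R * (w z - w z.+1) * w x +
      (x <= z < x + i)%N%:R * (w z - w z.+1) * w (x + j)%N).
  under [X in _ * X]eq_bigr => y _ do rewrite /flow_coef big_distrl /=.
  rewrite exchange_big big_distrr /=; apply: eq_bigr => x _.
  rewrite -(@sum_eq_pick w M.+1 (x + j)) // -[in RHS](@sum_eq_pick w M.+1 x) //.
  rewrite !big_distrr -big_split /= !big_distrr /=; apply: eq_bigr => y _.
  by rewrite -!mulnb !natrM; ring.
rewrite (eq_bigr _ (fun z _ => E z)) exchange_big /=; apply: eq_bigr => x _.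
rewrite -big_distrr big_split -!big_distrl /= !telescope_window //; try lia.
by rewrite -addn1; congr (_ * _); ring.
Qed.

Section Coef.
Variables (a : nat -> R) (A : R) (M i j m : nat).
Hypothesis a_bnd : forall x, (x < M)%N -> 0 <= a x <= A.
Hypothesis A_ge0 : 0 <= A.
Hypotheses (ij : (i < j)%N) (jm : (j <= m)%N).

Lemma flow_coef_ge0 z y : 0 <= flow_coef a M i j z y.
Proof.
apply: sumr_ge0 => x _; rewrite mulr_ge0 ?addr_ge0 ?ler0n //.
by have /andP[] := a_bnd (ltn_ord x).
Qed.

(** For a given [y] only [x = y] and [x = y - j] can contribute. *)
Lemma flow_coef_le z y : flow_coef a M i j z y <= 2 * A.
Proof.
clear jm.
apply: (@le_trans _ _ (\sum_(x < M) A * ((y == x :> nat)%:R + (y - j == x)%N%:R))).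
  apply: ler_sum => x _; have /andP[a0 aA] := a_bnd (ltn_ord x).
  apply: ler_pM => //.
  by rewrite lerD // ler_nat; lia.
rewrite -big_distrr big_split /= mulrC; apply: ler_wpM2r => //.
by rewrite [2]mulrSr lerD // sum_eq_le1.
Qed.

(** Moving the second point first keeps the two points from meeting. Hence the field that multiplies
    [w z - w z.+1] involves neither [z] nor [z.+1], as integration by parts on that bond
    requires. *)
Lemma flow_coef0 z : flow_coef a M i j z z = 0.
Proof.
clear - ij.
apply: big1 => x _; rewrite (_ : (_ && _) = false); last by lia.
by rewrite (_ : (_ && _) = false) ?addr0 ?mulr0 //; lia.
Qed.

Lemma flow_coef0S z : flow_coef a M i j z z.+1 = 0.
Proof.
clear - ij.
apply: big1 => x _; rewrite (_ : (_ && _) = false); last by lia.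
by rewrite (_ : (_ && _) = false) ?addr0 ?mulr0 //; lia.
Qed.

Lemma sum_flow_coef_le :
  \sum_(z < M.+1) \sum_(y < M.+1) flow_coef a M i j z y <=
  2 * m%:R * \sum_(x < M) a x.
Proof.
under eq_bigr => z _ do rewrite /flow_coef exchange_big.
rewrite exchange_big /= mulr_sumr; apply: ler_sum => x _.
have /andP[a0 aA] := a_bnd (ltn_ord x).
under eq_bigr => z _ do rewrite -big_distrr.
rewrite -big_distrr /= mulrC; apply: ler_wpM2r => //.
apply: (@le_trans _ _ (\sum_(z < M.+1) ((x <= z < x + m)%N%:R + (x <= z < x + m)%N%:R))).
  apply: ler_sum => z _; rewrite big_split /=; apply: lerD.
    apply: (@le_trans _ _ (\sum_(y < M.+1) (x <= z < x + m)%N%:R * (x == y :> nat)%:R)).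
      by apply: ler_sum => y _; rewrite -natrM ler_nat mulnb; lia.
    by rewrite -big_distrr /= -[leRHS]mulr1 ler_wpM2l ?sum_eq_le1.
  apply: (@le_trans _ _ (\sum_(y < M.+1) (x <= z < x + m)%N%:R * (x + j == y)%N%:R)).
    by apply: ler_sum => y _; rewrite -natrM ler_nat mulnb; lia.
  by rewrite -big_distrr /= -[leRHS]mulr1 ler_wpM2l ?sum_eq_le1.
by rewrite big_split /= [2 * _]mulr_natl mulr2n lerD // sum_window_le.
Qed.

(** One factor of the square is bounded by [2 * A] and the other is summed, so the bound stays
    linear in the sum of [a]. *)
Lemma sum_flow_coef_sqr_le :
  \sum_(z < M.+1) \sum_(y < M.+1) flow_coef a M i j z y ^+ 2 <=
  4 * A * m%:R * \sum_(x < M) a x.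
Proof.
apply: (@le_trans _ _ (2 * A * \sum_(z < M.+1) \sum_(y < M.+1) flow_coef a M i j z y)).
  rewrite big_distrr /=; apply: ler_sum => z _.
  rewrite big_distrr /=; apply: ler_sum => y _.
  by rewrite expr2 ler_wpM2r ?flow_coef_ge0 ?flow_coef_le.
apply: le_trans (ler_wpM2l _ sum_flow_coef_le) _; first by rewrite mulr_ge0.
by rewrite le_eqVlt; apply/orP; left; apply/eqP; ring.
Qed.

End Coef.
End Windows.

(* The lattice point [k.+1], for [k <= M]; larger [k] give a junk value. *)
Definition pt (M k : nat) : lattice M.+2 := inord k.

Lemma ptK M (x : lattice M.+2) : pt M (x : 'I_M.+1) = x.
Proof. exact: inord_val. Qed.

Lemma pt_val M k : (k <= M)%N -> (pt M k : 'I_M.+1) = k :> nat.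
Proof. by move=> kM; rewrite /pt inordK. Qed.

Lemma pt_eq M k l : (k <= M)%N -> (l <= M)%N -> (pt M k == pt M l) = (k == l).
Proof.
move=> kM lM; apply/eqP/eqP => [kl|-> //].
by rewrite -(pt_val kM) -(pt_val lM) kl.
Qed.

Lemma sum_lattice (R : nmodType) M (F : lattice M.+2 -> R) :
  \sum_x F x = \sum_(k < M.+1) F (pt M k).
Proof. by apply: eq_bigr => x _; rewrite ptK. Qed.

(** The exponential dominates [(1 + 1/n)^n (1 + kappa/(n e))^n], the loss along a chain of at most n
    bonds; the prefactor comes from [(n - 1)(n + 1) / e <= 2 n^2 / e]. *)
Definition energy_const (R : realType) (e kappa : R) := 2 / e * expR (1 + kappa / e).

(** * One-site energies along the lattice, and the cost of transporting a pair *)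

Section Chain.
Variables (R : realType) (M : nat) (u : lattice M.+2 -> R) (e kappa : R).
Implicit Types (f : config M.+2 -> R) (a : nat -> R).
Hypothesis e_gt0 : 0 < e.
Hypothesis u_int : forall x, e <= u x <= 1 - e.
Hypothesis u_lip : forall k, (k < M)%N ->
  `|u (pt M k.+1) - u (pt M k)| <= kappa / M.+2%:R.
Hypothesis kappa_ge0 : 0 <= kappa.

Let n : R := M.+2%:R.

Let n_gt0 : 0 < n. Proof. by rewrite ltr0n. Qed.

Let e_le1 : e <= 1.
Proof. by have /andP[h1 h2] := u_int (pt M 0); move: e_gt0 h1 h2; lra. Qed.

(* The energy of the exchanges and of the reservoir at the right end, which
   alone controls all the one-site energies. *)
Definition reservoir_energy f : R :=
  n ^+ 2 * (\sum_(k < M) exchange_energy u f (pt M k) (pt M k.+1) +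
            site_energy u f (pt M M)).

Lemma reservoir_energy_ge0 f : 0 <= reservoir_energy f.
Proof.
rewrite mulr_ge0 ?sqr_ge0 // addr_ge0 //; last exact: (site_energy_ge0 e_gt0 u_int).
by apply: sumr_ge0 => k _; exact: (exchange_energy_ge0 e_gt0 u_int).
Qed.

Lemma site_energy_chain f j k : (k + j = M)%N ->
  site_energy u f (pt M k) <=
  ((1 + n^-1) * (1 + kappa / n / e)) ^+ j * ((1 + n) / e) *
  (\sum_(k <= i < M) exchange_energy u f (pt M i) (pt M i.+1) +
   site_energy u f (pt M M)).
Proof.
set r := (1 + n^-1) * _ => kjM.
have rge1 : 1 <= r.
  have c1 : 1 <= 1 + n^-1 by rewrite lerDl invr_ge0 ltW.
  have c2 : 1 <= 1 + kappa / n / e by rewrite lerDl !divr_ge0 // ltW.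
  by rewrite /r -[leLHS]mulr1 ler_pM.
have ne1 : 1 <= (1 + n) / e.
  by rewrite ler_pdivlMr // mul1r (le_trans e_le1) // lerDl ltW.
elim: j k kjM => [|j IH] k kjM.
  have -> : k = M by lia.
  rewrite big_geq // add0r expr0 mul1r -[leLHS]mul1r ler_wpM2r //.
  exact: site_energy_ge0 e_gt0 u_int _ _.
have kM : (k < M)%N by lia.
have pp : pt M k != pt M k.+1 by rewrite pt_eq; lia.
(* Young's parameter is [n]: each step then loses only a factor [1 + 1/n], and the factor [1 + n] in
   front of the exchange energy is affordable because exchanges are speeded up by [n ^ 2]. *)
have := site_energy_step e_gt0 u_int f pp n_gt0 (u_lip kM).
have := IH k.+1; rewrite addSnnS => /(_ kjM).
rewrite (big_ltn kM) -/r; set Fk := exchange_energy _ _ _ _.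
set T := _ + site_energy u f (pt M M) => h1 h2.
have F0 : 0 <= Fk by exact: exchange_energy_ge0 e_gt0 u_int _ _ _.
apply: le_trans h2 _; rewrite -addrA -/T mulrDr; apply: lerD.
  apply: ler_wpM2r => //; rewrite -[leLHS]mul1r; apply: ler_wpM2r.
    exact: le_trans ler01 ne1.
  exact: exprn_ege1.
by have := ler_wpM2l (le_trans ler01 rge1) h1; rewrite !mulrA -exprS.
Qed.

Lemma site_energy_le f :
  \sum_x site_energy u f x <= energy_const e kappa * reservoir_energy f.
Proof.
rewrite sum_lattice; set Fs := \sum_(k < M) exchange_energy u f (pt M k) (pt M k.+1).
set A := site_energy u f (pt M M).
have A0 : 0 <= A by exact: site_energy_ge0 e_gt0 u_int _ _.
have F0 k : 0 <= exchange_energy u f (pt M k) (pt M k.+1).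
  exact: exchange_energy_ge0 e_gt0 u_int _ _ _.
have Fs0 : 0 <= Fs by rewrite sumr_ge0.
have site k : (k <= M)%N ->
    site_energy u f (pt M k) <= expR (1 + kappa / e) * ((1 + n) / e) * (Fs + A).
  move=> kM; have kM' : (k + (M - k) = M)%N by lia.
  apply: le_trans (site_energy_chain f kM') _.
  have en : 0 <= (1 + n) / e by rewrite divr_ge0 ?addr_ge0 ?ltW.
  have nV : 0 <= n^-1 by rewrite invr_ge0 ltW.
  have kne : 0 <= kappa / n / e by rewrite !divr_ge0 // ltW.
  apply: ler_pM.
  - by rewrite mulr_ge0 // exprn_ge0 // mulr_ge0 // addr_ge0.
  - by rewrite addr_ge0 // sumr_ge0.
  - apply: ler_wpM2r => //.
    apply: (@le_trans _ _ (expR (n^-1 + kappa / n / e) ^+ (M - k))).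
      rewrite lerXn2r ?nnegrE ?expR_ge0 //; first by rewrite mulr_ge0 // addr_ge0.
      by rewrite expRD ler_pM ?expR_ge1Dx // addr_ge0.
    rewrite -expRM_natl ler_expR.
    rewrite [leRHS](_ : _ = n * (n^-1 + kappa / n / e)); last first.
      by field; rewrite !gt_eqF.
    apply: ler_wpM2r; first by rewrite addr_ge0.
    by rewrite ler_nat; lia.
  - rewrite lerD2r /Fs -(big_mkord xpredT (fun i => exchange_energy u f (pt M i) (pt M i.+1))).
    by rewrite [leRHS](big_cat_nat _ (n := k)) //= lerDr sumr_ge0.
apply: (@le_trans _ _ (\sum_(k < M.+1) expR (1 + kappa / e) * ((1 + n) / e) * (Fs + A))).
  by apply: ler_sum => k _; apply: site; rewrite -ltnS.
rewrite sumr_const card_ord -mulr_natl /energy_const /reservoir_energy -/Fs -/A !mulrA.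
apply: ler_wpM2r; first by rewrite addr_ge0.
rewrite -!mulrA [in leLHS]mulrCA [leRHS](_ : _ = expR (1 + kappa / e) * (2 * n ^+ 2 / e)); last by ring.
apply: ler_wpM2l; first exact: expR_ge0.
rewrite mulrA ler_pM2r ?invr_gt0 // expr2 mulrA.
rewrite /n; move: n_gt0; rewrite /n -[M.+2%:R]natr1 -natr1; have := ler0n R M; nra.
Qed.

(** Extended by zero, so that windows sticking out of the lattice need no separate treatment. *)
Definition omega_at k (eta : config M.+2) : R :=
  if (k <= M)%N then omega u (pt M k) eta else 0.

Lemma omega_at_gt k eta : (M < k)%N -> omega_at k eta = 0.
Proof. by rewrite /omega_at ltnNge => /negbTE ->. Qed.

Lemma omega_at_abs k eta : `|omega_at k eta| <= e^-1.
Proof.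
rewrite /omega_at; case: ifP => _; first exact: omega_abs.
by rewrite normr0 invr_ge0 ltW.
Qed.

Lemma omega_at_sqr k eta : omega_at k eta ^+ 2 <= e ^- 2.
Proof.
rewrite /omega_at; case: ifP => _; first exact: omega_sqr.
by rewrite expr0n invr_ge0 sqr_ge0.
Qed.

Section Transport.
Variables (f : config M.+2 -> R) (a : nat -> R) (A : R) (i j m : nat).
Hypothesis a_bnd : forall x, (x < M)%N -> 0 <= a x <= A.
Hypothesis A_ge0 : 0 <= A.
Hypotheses (ij : (i < j)%N) (jm : (j <= m)%N).

Let V := expect u (fun eta => f eta ^+ 2).
Let S := \sum_x site_energy u f x.
Let abar := (\sum_(x < M) a x) / n.

Let flow z eta := \sum_(y < M.+1) flow_coef a M i j z y * omega_at y eta.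

Let flowE z eta : flow z eta =
  \sum_(y : lattice M.+2) flow_coef a M i j z (y : 'I_M.+1) * omega u y eta.
Proof.
rewrite sum_lattice; apply: eq_bigr => y _; have yM : (y <= M)%N by rewrite -ltnS.
by rewrite /omega_at yM pt_val.
Qed.

Let flow_upd z k eta b : (k <= M)%N -> flow_coef a M i j z k = 0 ->
  flow z (upd eta (pt M k) b) = flow z eta.
Proof.
move=> kM zk; rewrite !flowE; apply: eq_bigr => y _.
have [->|yk] := eqVneq y (pt M k); first by rewrite pt_val // zk !mul0r.
by rewrite omega_upd.
Qed.

Let V_ge0 : 0 <= V.
Proof. by apply: (expect_ge0 e_gt0 u_int) => eta; exact: sqr_ge0. Qed.

Let S_ge0 : 0 <= S.
Proof. by apply: sumr_ge0 => x _; exact: (site_energy_ge0 e_gt0 u_int). Qed.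

Let asum_ge0 : 0 <= \sum_(x < M) a x.
Proof. by apply: sumr_ge0 => x _; have /andP[] := a_bnd (ltn_ord x). Qed.

Let abar_ge0 : 0 <= abar.
Proof. by rewrite divr_ge0 // ltW. Qed.

Let abar_le : abar <= A.
Proof.
rewrite ler_pdivrMr //; apply: (@le_trans _ _ (\sum_(x < M) A)).
  by apply: ler_sum => x _; have /andP[] := a_bnd (ltn_ord x).
by rewrite sumr_const card_ord -mulr_natr ler_wpM2l // ler_nat; lia.
Qed.

(** The squared coefficients sum to order [A m n abar]. Relative to [n ^ 2] this leaves the factor
    [m / n], the smallness of the transport error; [abar] is kept in front of [V] only. *)
Let flow_sqr_le :
  \sum_(z < M.+1) expect u (fun eta => flow z eta ^+ 2 * f eta ^+ 2) <=
  n ^+ 2 * (128 * A / e ^+ 2 * (m%:R / n) * (abar * V + A * S)).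
Proof.
apply: (@le_trans _ _ (\sum_(z < M.+1) (\sum_(y < M.+1) flow_coef a M i j z y ^+ 2) *
   (32 / e ^+ 2 * (V + S)))).
  apply: ler_sum => z _.
  rewrite (eq_expect _ (g := fun eta => (\sum_y flow_coef a M i j z (y : 'I_M.+1) * omega u y eta) ^+ 2 * f eta ^+ 2));
    last by move=> eta; rewrite flowE.
  apply: le_trans (expect_linear_sqr e_gt0 u_int _ _) _.
  rewrite sum_lattice (eq_bigr (fun y : 'I_M.+1 => flow_coef a M i j z y ^+ 2)); last first.
    by move=> y _; rewrite pt_val // -ltnS.
  apply: ler_wpM2l; first by apply: sumr_ge0 => y _; exact: sqr_ge0.
  rewrite -/V -/S mulrDr lerD2r; apply: ler_wpM2r => //.
  by rewrite ler_pM2r ?invr_gt0 ?exprn_gt0 //; lra.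
rewrite -big_distrl /=.
have VS : 0 <= 32 / e ^+ 2 * (V + S) by rewrite mulr_ge0 ?addr_ge0 ?divr_ge0 ?sqr_ge0.
apply: le_trans (ler_wpM2r VS (sum_flow_coef_sqr_le a_bnd A_ge0 ij jm)) _.
rewrite [leLHS](_ : _ = n ^+ 2 * (128 * A / e ^+ 2 * (m%:R / n) * (abar * (V + S)))); last first.
  by rewrite /abar; field; rewrite !gt_eqF.
apply: ler_wpM2l; first exact: sqr_ge0.
apply: ler_wpM2l.
  by rewrite mulr_ge0 ?divr_ge0 ?mulr_ge0 ?ler0n ?sqr_ge0 // ltW.
by rewrite mulrDr lerD2l ler_wpM2r.
Qed.

Lemma pair_transport_bound (b s : R) : 0 < b -> 0 < s ->
  `|\sum_(x < M) a x * expect u (fun eta =>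
      (omega_at x eta * omega_at x.+1 eta - omega_at (x + i) eta * omega_at (x + j) eta)
      * f eta ^+ 2)| <=
  b / e * reservoir_energy f + kappa * s * S +
  ((b * e ^+ 2)^-1 + kappa / (s * e ^+ 3)) *
    (128 * A / e ^+ 2 * (m%:R / n) * (abar * V + A * S)).
Proof.
move=> b0 s0.
pose B z := expect u (fun eta => flow z eta ^+ 2 * f eta ^+ 2).
have B_ge0 z : 0 <= B z by exact: (expect_sqrM_ge0 e_gt0 u_int).
pose K := (b * e ^+ 2)^-1 + kappa / (s * e ^+ 3).
have K1 : 0 <= (b * e ^+ 2)^-1 by rewrite invr_ge0 mulr_ge0 ?sqr_ge0 // ltW.
have K2 : 0 <= kappa / (s * e ^+ 3).
  by rewrite divr_ge0 // mulr_ge0 ?exprn_ge0 // ltW.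
rewrite (_ : \sum_(x < M) _ = \sum_(z < M.+1) expect u (fun eta =>
    (omega_at z eta - omega_at z.+1 eta) * (flow z eta * f eta ^+ 2))); last first.
  rewrite -expect_sum; under eq_bigr => x _ do rewrite -expectZ.
  rewrite -expect_sum; apply: eq_expect => eta.
  have w0 k : (M < k)%N -> omega_at k eta = 0 by exact: omega_at_gt.
  under eq_bigr => x _ do rewrite mulrA.
  under [RHS]eq_bigr => x _ do rewrite mulrA.
  rewrite -!big_distrl /= (@flow_decomposition _ (omega_at ^~ eta) a M i j w0) //.
  exact: leq_ltn_trans ij.
apply: (@le_trans _ _ (\sum_(z < M) (b / e * (n ^+ 2 * exchange_energy u f (pt M z) (pt M z.+1)) +
    kappa * s * site_energy u f (pt M z) + K / n ^+ 2 * B z) +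
    (b / e * (n ^+ 2 * site_energy u f (pt M M)) + K / n ^+ 2 * B M))).
  apply: le_trans (ler_norm_sum _ _ _) _; rewrite big_ord_recr /=; apply: lerD.
    apply: ler_sum => z _; have zM := ltn_ord z.
    rewrite (eq_expect _ (g := fun eta => (omega u (pt M z) eta - omega u (pt M z.+1) eta) *
      (flow z eta * f eta ^+ 2))); last first.
      by move=> eta; rewrite /omega_at zM ltnW.
    have pp : pt M z != pt M z.+1 by rewrite pt_eq ?(ltnW zM) // neq_ltn ltnSn.
    (* The parameters are scaled so that the exchange energy carries [n ^ 2] as in
       [reservoir_energy], the site energy carries no power of [n] because
       [kappa / n * (s * n) = kappa * s], and the field term carries [n ^- 2]. *)
    have bn : 0 < b * n ^+ 2 by rewrite mulr_gt0 ?exprn_gt0.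
    have sn : 0 < s * n by rewrite mulr_gt0.
    apply: le_trans (expect_bond_form e_gt0 u_int f pp bn sn (u_lip zM) _ _) _.
    - by move=> eta c; apply: (flow_upd _ _ (ltnW zM)); exact: flow_coef0.
    - by move=> eta c; apply: (flow_upd _ _ zM); exact: flow_coef0S.
    rewrite -/(B z) le_eqVlt; apply/orP; left; apply/eqP; rewrite /K -/n.
    by field; rewrite !gt_eqF.
  (* At the last bond the gradient is [omega] at the right end alone, since [omega_at] vanishes
     beyond it; this term is charged to the reservoir. *)
  rewrite (eq_expect _ (g := fun eta => omega u (pt M M) eta * (flow M eta * f eta ^+ 2))); last first.
    by move=> eta; rewrite /omega_at leqnn ltnn subr0.
  have bn : 0 < b * n ^+ 2 by rewrite mulr_gt0 ?exprn_gt0.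
  apply: le_trans (expect_omega_form e_gt0 u_int f bn _) _.
    by move=> eta c; apply: (flow_upd _ _ (leqnn M)); exact: flow_coef0.
  apply: lerD.
    rewrite -mulrA; apply: ler_wpM2r; last by rewrite ler_pdivlMr // ler_piMr // ltW.
    by rewrite mulr_ge0 ?sqr_ge0 //; exact: (site_energy_ge0 e_gt0 u_int).
  apply: ler_wpM2r; first exact: B_ge0.
  rewrite [leLHS](_ : _ = (b * e)^-1 / n ^+ 2); last first.
    by field; rewrite !gt_eqF.
  apply: ler_wpM2r; first by rewrite invr_ge0 sqr_ge0.
  apply: (@le_trans _ _ (b * e ^+ 2)^-1); last by rewrite /K lerDl.
  rewrite lef_pV2 ?posrE ?mulr_gt0 ?exprn_gt0 //.
  by rewrite ler_pM2l // expr2 ler_piMl // ltW.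
have SM : \sum_(z < M) site_energy u f (pt M z) <= S.
  rewrite /S sum_lattice big_ord_recr /= lerDl.
  exact: (site_energy_ge0 e_gt0 u_int).
rewrite -/K; apply: (@le_trans _ _ (b / e * reservoir_energy f +
   kappa * s * \sum_(z < M) site_energy u f (pt M z) + K / n ^+ 2 * \sum_(z < M.+1) B z)).
  rewrite big_ord_recr /= !big_split /= -!big_distrr /= /reservoir_energy.
  by rewrite le_eqVlt; apply/orP; left; apply/eqP; ring.
apply: lerD.
  by rewrite lerD2l ler_wpM2l // mulr_ge0 // ltW.
rewrite -mulrA; apply: ler_wpM2l; first by rewrite addr_ge0.
by rewrite mulrC ler_pdivrMr ?exprn_gt0 // mulrC; exact: flow_sqr_le.
Qed.

End Transport.
End Chain.

(** * Averaging over a macroscopic window *)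

Section Averaging.
Variables (R : realType) (e kappa : R).
Hypothesis e_gt0 : 0 < e.
Hypothesis kappa_ge0 : 0 <= kappa.

Lemma energy_const_gt0 : 0 < energy_const e kappa.
Proof. by rewrite mulr_gt0 ?divr_gt0 ?expR_gt0. Qed.

Lemma pair_transport_uniform : exists2 K : R, 0 <= K &
  forall (M : nat) (u : lattice M.+2 -> R) (f : config M.+2 -> R) (a : nat -> R)
    (i j m : nat),
  (forall x, e <= u x <= 1 - e) ->
  (forall k, (k < M)%N -> `|u (pt M k.+1) - u (pt M k)| <= kappa / M.+2%:R) ->
  (forall x, (x < M)%N -> 0 <= a x <= kappa ^+ 2) -> (i < j)%N -> (j <= m)%N ->
  `|\sum_(x < M) a x * expect u (fun eta =>
      (omega_at u x eta * omega_at u x.+1 eta -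
       omega_at u (x + i) eta * omega_at u (x + j) eta) * f eta ^+ 2)| <=
  e / 4 * reservoir_energy u f + K * (m%:R / M.+2%:R) *
    ((\sum_(x < M) a x) / M.+2%:R * expect u (fun eta => f eta ^+ 2) + reservoir_energy u f).
Proof.
pose C := energy_const e kappa; have C0 : 0 < C := energy_const_gt0.
(* Each choice spends [e / 8] of the reservoir energy: [b] through the exchanges, [s] through the
   site energies, which [C] converts. The summand 1 in [kappa + 1] avoids dividing by zero. *)
pose b := e ^+ 2 / 8; pose s := e / (8 * (kappa + 1) * C).
have k1 : 0 < kappa + 1 by move: kappa_ge0; lra.
have b0 : 0 < b by rewrite divr_gt0 ?exprn_gt0.
have s0 : 0 < s by rewrite divr_gt0 // mulr_gt0 // mulr_gt0.
pose K0 := ((b * e ^+ 2)^-1 + kappa / (s * e ^+ 3)) * (128 * kappa ^+ 2 / e ^+ 2).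
have K00 : 0 <= K0.
  apply: mulr_ge0; last by rewrite divr_ge0 ?sqr_ge0 // mulr_ge0 ?sqr_ge0.
  apply: addr_ge0; first by rewrite invr_ge0 mulr_ge0 ?sqr_ge0 // ltW.
  by rewrite divr_ge0 // mulr_ge0 ?exprn_ge0 // ltW.
have A0 : 0 <= kappa ^+ 2 * C by rewrite mulr_ge0 ?sqr_ge0 // ltW.
exists (K0 * (1 + kappa ^+ 2 * C)); first by rewrite mulr_ge0 // addr_ge0.
move=> M u f a i j m u_int u_lip a_bnd ij jm.
have := pair_transport_bound e_gt0 u_int u_lip kappa_ge0 f a_bnd (sqr_ge0 _) ij jm b0 s0.
have := site_energy_le e_gt0 u_int u_lip kappa_ge0 f; rewrite -/C.
have := reservoir_energy_ge0 e_gt0 u_int f.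
set T := `|_|; set F := reservoir_energy u f; set S := \sum_x site_energy u f x.
set V := expect u (fun eta => f eta ^+ 2); set abar := (\sum_(x < M) a x) / M.+2%:R.
move=> F0 SF hT.
have V0 : 0 <= V by apply: (expect_ge0 e_gt0 u_int) => eta; exact: sqr_ge0.
have abar0 : 0 <= abar.
  rewrite divr_ge0 ?ler0n // sumr_ge0 // => x _.
  by have /andP[] := a_bnd _ (ltn_ord x).
have mn : 0 <= m%:R / M.+2%:R :> R by rewrite divr_ge0.
apply: le_trans hT _.
rewrite (_ : b / e = e / 8); last by rewrite /b; field; rewrite gt_eqF.
have ks : kappa * s * S <= e / 8 * F.
  apply: (@le_trans _ _ (kappa * s * (C * F))).
    by rewrite ler_wpM2l // mulr_ge0 // ltW.
  rewrite mulrA; apply: ler_wpM2r => //.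
  rewrite (_ : kappa * s * C = e / 8 * (kappa / (kappa + 1))); last first.
    by rewrite /s; field; rewrite !gt_eqF.
  rewrite -[leRHS]mulr1; apply: ler_wpM2l; first by rewrite divr_ge0 // ltW.
  by rewrite ler_pdivrMr // mul1r lerDl.
have S_F : abar * V + kappa ^+ 2 * S <= (1 + kappa ^+ 2 * C) * (abar * V + F).
  have h1 := ler_wpM2l (sqr_ge0 kappa) SF.
  have h2 := mulr_ge0 A0 (mulr_ge0 abar0 V0).
  rewrite mulrDr !mulrDl; rewrite mulrA in h1.
  by lra.
have last_term : K0 * (m%:R / M.+2%:R * (abar * V + kappa ^+ 2 * S)) <=
    K0 * (1 + kappa ^+ 2 * C) * (m%:R / M.+2%:R) * (abar * V + F).
  rewrite -[leRHS]mulrA -[leRHS]mulrA; apply: ler_wpM2l => //.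
  by rewrite mulrCA; apply: ler_wpM2l.
rewrite [X in _ + X <= _](_ : _ = K0 * (m%:R / M.+2%:R * (abar * V + kappa ^+ 2 * S))).
  rewrite (_ : e / 4 = e / 8 + e / 8) ?mulrDl; last by field.
  exact: lerD (lerD (lexx _) ks) last_term.
by rewrite /K0; ring.
Qed.

(* The coefficients enter with the favourable sign: averaging the two points of
   the product over a mesoscopic window turns it into a square. *)
Lemma gradient_form_bound : exists2 C : R, 0 <= C &
  forall (M : nat) (u : lattice M.+2 -> R) (f : config M.+2 -> R) (a : nat -> R),
  (forall x, e <= u x <= 1 - e) ->
  (forall k, (k < M)%N -> `|u (pt M k.+1) - u (pt M k)| <= kappa / M.+2%:R) ->
  (forall x, (x < M)%N -> 0 <= a x <= kappa ^+ 2) ->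
  - \sum_(x < M) a x * expect u (fun eta =>
      omega_at u x eta * omega_at u x.+1 eta * f eta ^+ 2) <=
  e / 2 * reservoir_energy u f +
  C * ((\sum_(x < M) a x) / M.+2%:R) * expect u (fun eta => f eta ^+ 2).
Proof.
have [K K0 transport] := pair_transport_uniform.
(* The window has [n / L] sites, with [L] so large that the transport error [K / L] is at most
   [e / 4]. *)
pose L := (Num.bound (4 * K / e)).+1.
have KL : K / L%:R <= e / 4.
  have Ke : 0 <= 4 * K / e by rewrite divr_ge0 ?mulr_ge0 // ltW.
  have : 4 * K / e < L%:R by apply: lt_trans (archi_boundP Ke) _; rewrite ltr_nat.
  by rewrite ler_pdivrMr ?ltr0n // ltr_pdivrMr //; lra.
have L0 : 0 < L%:R :> R by rewrite ltr0n.
have LKC : 0 <= K + 2 * L%:R / e ^+ 2 by rewrite addr_ge0 // divr_ge0 ?mulr_ge0 ?sqr_ge0 // ltW.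
exists (K + 2 * L%:R / e ^+ 2) => // M u f a u_int u_lip a_bnd.
set V := expect u (fun eta => f eta ^+ 2); set F := reservoir_energy u f.
set n : R := M.+2%:R; set abar := (\sum_(x < M) a x) / n; set I := \sum_(x < M) _.
have n0 : 0 < n by rewrite ltr0n.
have V0 : 0 <= V by apply: (expect_ge0 e_gt0 u_int) => eta; exact: sqr_ge0.
have F0 : 0 <= F := reservoir_energy_ge0 e_gt0 u_int f.
have a0 x : (x < M)%N -> 0 <= a x by move=> /a_bnd /andP[].
have as0 : 0 <= \sum_(x < M) a x by apply: sumr_ge0 => x _; exact: a0.
have abar0 : 0 <= abar by rewrite divr_ge0 // ltW.
have aV0 : 0 <= abar * V by rewrite mulr_ge0.
have asumE : \sum_(x < M) a x = n * abar by rewrite /abar mulrC divfK // gt_eqF.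
pose m := (M.+2 %/ L)%N.
have mL : (m * L <= M.+2)%N by exact: leq_trunc_div.
have Lm : (M.+2 < m.+1 * L)%N by rewrite ltn_ceil.
have eV : 0 <= e ^- 2 by rewrite invr_ge0 sqr_ge0.
(* If the window is empty then [n] is at most [L], and the pointwise bound on [omega_at] is
   enough. *)
have [m0|m_gt0] := posnP m.
  have nL : n <= L%:R by rewrite ler_nat; move: Lm; rewrite m0 mul1n => /ltnW.
  have : - I <= \sum_(x < M) a x * (e ^- 2 * V).
    rewrite -sumrN; apply: ler_sum => x _; rewrite -mulrN; apply: ler_wpM2l; first exact: a0.
    apply: le_trans (ler_norm _) _; rewrite normrN -expectZ.
    apply: (expect_abs_le e_gt0 u_int) => eta.
    rewrite normrM [`|f eta ^+ 2|]ger0_norm ?sqr_ge0 //.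
    apply: ler_wpM2r; first exact: sqr_ge0.
    by rewrite normrM -exprVn expr2 ler_pM // (omega_at_abs e_gt0 u_int).
  rewrite -mulr_suml asumE => hI; apply: le_trans hI _.
  have h1 : n * (abar * V * e ^- 2) <= L%:R * (abar * V * e ^- 2).
    by rewrite ler_wpM2r // mulr_ge0.
  have h2 : 0 <= K * (abar * V) by rewrite mulr_ge0.
  have h3 : 0 <= e / 2 * F by rewrite mulr_ge0 // divr_ge0 // ltW.
  have h4 : 0 <= L%:R * (abar * V * e ^- 2) by rewrite mulr_ge0 ?ler0n // mulr_ge0.
  rewrite (_ : n * abar * _ = n * (abar * V * e ^- 2)); last by ring.
  rewrite [leRHS](_ : _ = e / 2 * F + (K * (abar * V) + 2 * (L%:R * (abar * V * e ^- 2)))); last by ring.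
  by lra.
pose J i j := \sum_(x < M) a x * expect u (fun eta =>
      omega_at u (x + i) eta * omega_at u (x + j) eta * f eta ^+ 2).
pose Err := e / 4 * F + K * (m%:R / n) * (abar * V + F).
have step i j : (i < j)%N -> (j <= m)%N -> - I - Err <= - J i j.
  move=> ij jm; have := transport M u f a i j m u_int u_lip a_bnd ij jm.
  rewrite -/F -/V -/n -/abar -/Err => h; have := le_trans (ler_norm _) (eq_ind_r (fun t => t <= _) h (normrN _)).
  rewrite (_ : \sum_(x < M) _ = I - J i j); first by lra.
  rewrite /I /J -sumrB; apply: eq_bigr => x _; rewrite -mulrBr -expectB.
  by congr (_ * _); apply: eq_expect => eta; ring.
(* For each [x] the off-diagonal pairs complete to a square, so only the [m.+1] diagonal terms
   remain. *)
have sumJ : - (\sum_(j < m.+1) \sum_(i < j) J i j) <=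
    \sum_(x < M) a x * (m.+1%:R / 2 * e ^- 2 * V).
  rewrite /J; under eq_bigr => j _ do rewrite exchange_big.
  rewrite exchange_big -sumrN; apply: ler_sum => x _ /=.
  under eq_bigr => j _ do rewrite -mulr_sumr -expect_sum.
  rewrite -mulr_sumr -expect_sum -mulrN -expectN; apply: ler_wpM2l; first exact: a0.
  rewrite -expectZ; apply: (ler_expect e_gt0 u_int) => eta.
  under eq_bigr => j _ do rewrite -mulr_suml.
  rewrite -mulr_suml -mulNr; apply: ler_wpM2r; first exact: sqr_ge0.
  have := pair_sum_square (fun i => omega_at u (x + i) eta) m.+1.
  have : \sum_(j < m.+1) omega_at u (x + j) eta ^+ 2 <= \sum_(j < m.+1) e ^- 2.
    by apply: ler_sum => j _; exact: (omega_at_sqr e_gt0 u_int).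
  rewrite sumr_const card_ord -[_ *+ m.+1]mulr_natr.
  have := sqr_ge0 (\sum_(j < m.+1) omega_at u (x + j) eta).
  set s1 := _ ^+ 2; set s2 := \sum_(j < m.+1) _; set s3 := \sum_(j < m.+1) _.
  set E := e ^- 2; rewrite [m.+1%:R / 2 * E](_ : _ = E * m.+1%:R / 2); last by ring.
  by lra.
have avg : (- I - Err) * (m%:R * m.+1%:R / 2) <= \sum_(x < M) a x * (m.+1%:R / 2 * e ^- 2 * V).
  apply: le_trans sumJ; rewrite -sum_pairs_cst -[leRHS]sumrN; apply: ler_sum => j _.
  by rewrite -[leRHS]sumrN; apply: ler_sum => i _; apply: step; rewrite // -ltnS.
have mR : 0 < m%:R :> R by rewrite ltr0n.
have n_le : n <= 2 * m%:R * L%:R.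
  rewrite -!natrM ler_nat; apply: leq_trans (ltnW Lm) _; by rewrite leq_mul2r mul2n -addnn -addn1 leq_add2l m_gt0 orbT.
have mn_L : m%:R / n <= L%:R^-1.
  by rewrite ler_pdivrMr // mulrC ler_pdivlMr // -natrM ler_nat.
have mn1 : m%:R / n <= 1.
  by rewrite ler_pdivrMr // mul1r ler_nat leq_div.
(* There are [m * m.+1 / 2] pairs against a diagonal of size [m.+1 / 2]: the average gains [1 / m],
   which makes up for the factor [n] since [n / m <= 2 * L]. *)
have final : - I - Err <= 2 * L%:R / e ^+ 2 * abar * V.
  rewrite -mulr_suml asumE in avg.
  have m1 : 0 < m%:R * m.+1%:R / 2 :> R by rewrite divr_gt0 ?mulr_gt0.
  rewrite -(ler_pM2r m1); apply: le_trans avg _.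
  rewrite [leLHS](_ : _ = n * (m.+1%:R / 2 * e ^- 2 * (abar * V))); last by ring.
  rewrite [leRHS](_ : _ = 2 * m%:R * L%:R * (m.+1%:R / 2 * e ^- 2 * (abar * V))); last by ring.
  by apply: ler_wpM2r => //; rewrite mulr_ge0 // mulr_ge0 // divr_ge0.
have e1 : K * (m%:R / n) * F <= e / 4 * F.
  apply: ler_wpM2r => //; apply: le_trans KL; exact: ler_wpM2l.
have e2 : K * (m%:R / n) * (abar * V) <= K * (abar * V).
  by apply: ler_wpM2r => //; rewrite -[leRHS]mulr1 ler_wpM2l.
rewrite [leRHS](_ : _ = e / 2 * F + K * (abar * V) + 2 * L%:R / e ^+ 2 * abar * V); last by ring.
move: final e1 e2; rewrite /Err.
set p := K * (m%:R / n); set q := abar * V; set r := _ * V => h1 h2 h3.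
rewrite mulrDr in h1.
have -> : e / 2 = e / 4 + e / 4 by field.
by lra.
Qed.

End Averaging.

(** * The generator and the dissipation of the chi-square distance *)

Section Generator.
Variables (R : realType) (M : nat) (rho : R).
Implicit Types (u w : lattice M.+2 -> R) (eta : config M.+2).
Implicit Types (f h : config M.+2 -> R).

Local Notation n := (M.+2%:R : R).
Local Notation L := (@ssep_generator R rho M.+2).

Definition boundary (x : lattice M.+2) := (site x == 1%N) || (site x == M.+2.-1).

Lemma boundary_right : boundary (pt M M).
Proof. by rewrite /boundary /site pt_val // eqxx orbT. Qed.

Definition reservoir_rate eta x : R := rho * (1 - (eta x)%:R) + (1 - rho) * (eta x)%:R.

Lemma sum_bonds (F : lattice M.+2 -> lattice M.+2 -> R) :
  \sum_x \sum_(y | site y == (site x).+1) F x y = \sum_(k < M) F (pt M k) (pt M k.+1).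
Proof.
rewrite sum_lattice big_ord_recr /= [X in _ + X]big1 ?addr0; last first.
  move=> y; rewrite /site pt_val // eqSS => /eqP yM.
  by have := ltn_ord (y : 'I_M.+1); rewrite yM ltnn.
apply: eq_bigr => k _; rewrite (big_pred1 (pt M k.+1)) // => y /=.
have kM := ltn_ord k.
rewrite /site pt_val ?(ltnW kM) // eqSS -[y in RHS]ptK pt_eq //.
by rewrite -ltnS.
Qed.

Lemma generatorE f eta : L f eta =
  n ^+ 2 * (\sum_(k < M) (f (exchange eta (pt M k) (pt M k.+1)) - f eta) +
            \sum_(x | boundary x) reservoir_rate eta x * (f (flip eta x) - f eta)).
Proof. by rewrite /ssep_generator sum_bonds mulrDr. Qed.

Lemma generator_sum (I : Type) (r : seq I) (F : I -> config M.+2 -> R) (c : I -> R) eta :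
  L (fun xi => \sum_(i <- r) c i * F i xi) eta = \sum_(i <- r) c i * L (F i) eta.
Proof.
under [RHS]eq_bigr => i _ do rewrite generatorE mulrCA mulrDr.
rewrite generatorE -mulr_sumr [X in _ = _ * X]big_split /=; congr (_ * (_ + _)).
  under [RHS]eq_bigr => i _ do rewrite mulr_sumr.
  rewrite exchange_big; apply: eq_bigr => k _.
  by rewrite -sumrB; apply: eq_bigr => i _; rewrite mulrBr.
under [RHS]eq_bigr => i _ do rewrite mulr_sumr.
rewrite exchange_big; apply: eq_bigr => x _.
by rewrite -sumrB mulr_sumr; apply: eq_bigr => i _; ring.
Qed.

Lemma generator_delta f eta :
  L f eta = \sum_xi f xi * L (fun zeta => (zeta == xi)%:R) eta.
Proof.
rewrite -generator_sum; congr (L _ eta); apply/funext => zeta.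
rewrite (bigD1 zeta) //= eqxx mulr1 big1 ?addr0 // => xi xi_zeta.
by rewrite eq_sym (negbTE xi_zeta) mulr0.
Qed.

(* [drift u w] is the time derivative of [\sum_x w x * u x] when [u] follows
   the discrete heat equation with boundary value [rho]. *)
Definition drift u w : R :=
  n ^+ 2 * (\sum_(k < M) (w (pt M k) - w (pt M k.+1)) * (u (pt M k.+1) - u (pt M k)) +
            \sum_(x | boundary x) w x * (rho - u x)).

Lemma generator_linear w eta :
  L (fun xi => \sum_x w x * (xi x)%:R) eta = drift (fun x => (eta x)%:R) w.
Proof.
rewrite generatorE /drift; congr (_ * (_ + _)).
  apply: eq_bigr => k _.
  have kM := ltn_ord k; set x := pt M k; set y := pt M k.+1.
  have xy : x != y by rewrite pt_eq ?(ltnW kM) // neq_ltn ltnSn.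
  rewrite -sumrB (bigD1 x) //= (bigD1 y) 1?eq_sym //= big1 ?addr0.
    by rewrite !ffunE tpermL tpermR; ring.
  move=> z /andP[zx zy]; rewrite ffunE tpermD 1?eq_sym ?subrr //.
apply: eq_bigr => x _; rewrite -sumrB (bigD1 x) //= big1 ?addr0.
  by rewrite /reservoir_rate ffunE eqxx; case: (eta x) => /=; ring.
by move=> z zx; rewrite ffunE (negbTE zx) subrr.
Qed.

Lemma drift_sum u w : drift u w = \sum_x w x * drift u (fun y => (y == x)%:R).
Proof.
under eq_bigr => x _ do rewrite /drift mulrCA mulrDr !mulr_sumr.
rewrite -mulr_sumr big_split /= /drift; congr (_ * (_ + _)).
  rewrite exchange_big; apply: eq_bigr => k _.
  under eq_bigr => x _ do rewrite mulrA [w x * _]mulrBr.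
  rewrite -mulr_suml sumrB; congr ((_ - _) * _).
    rewrite (bigD1 (pt M k)) //= eqxx mulr1 big1 ?addr0 // => x xk.
    by rewrite eq_sym (negbTE xk) mulr0.
  rewrite (bigD1 (pt M k.+1)) //= eqxx mulr1 big1 ?addr0 // => x xk.
  by rewrite eq_sym (negbTE xk) mulr0.
rewrite exchange_big; apply: eq_bigr => y _.
rewrite (bigD1 y) //= eqxx mul1r big1 ?addr0 // => x xk.
by rewrite eq_sym (negbTE xk) mul0r mulr0.
Qed.

(** The carré du champ; its expectation is the Dirichlet form of the overview, and it isolates the
    square [L (f ^ 2)] to which [expect_generator] applies. *)
Definition carre f eta := L (fun xi => f xi ^+ 2) eta - 2 * (f eta * L f eta).

Lemma carreE f eta : carre f eta =
  n ^+ 2 * (\sum_(k < M) (f (exchange eta (pt M k) (pt M k.+1)) - f eta) ^+ 2 +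
            \sum_(x | boundary x) reservoir_rate eta x * (f (flip eta x) - f eta) ^+ 2).
Proof.
rewrite /carre !generatorE mulrA [2 * _ * _]mulrCA -mulrBr; congr (_ * _).
rewrite mulrDr opprD addrACA !mulr_sumr -!sumrB.
by congr (_ + _); apply: eq_bigr => x _; ring.
Qed.

Section Interior.
Variables (u : lattice M.+2 -> R) (e : R).
Hypothesis e_gt0 : 0 < e.
Hypothesis u_int : forall x, e <= u x <= 1 - e.

Lemma expect_flip x h :
  expect u (fun eta => reservoir_rate eta x * (h (flip eta x) - h eta)) =
  (rho - u x) * expect u (fun eta => omega u x eta * h eta).
Proof.
rewrite (expect_omega e_gt0 u_int) -expectZ (expect_site u x).
rewrite [RHS](expect_site u x); apply: eq_expect => eta.
rewrite /reservoir_rate !flip_upd /site_grad !upd_same !upd_upd /=; ring.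
Qed.

(** An exchange contributes [u y - u x] times the exchange gradient, and trading that gradient for
    [omega u x - omega u y] leaves the square of [u y - u x]. The first-order part is what the time
    derivative of the reference measure cancels. *)
Lemma expect_generator h :
  expect u (L h) =
  expect u (fun eta => drift u (omega u ^~ eta) * h eta) -
  \sum_(k < M) n ^+ 2 * (u (pt M k.+1) - u (pt M k)) ^+ 2 *
    expect u (fun eta => omega_at u k eta * omega_at u k.+1 eta * h eta).
Proof.
rewrite (eq_expect _ (generatorE h)) expectZ expectD !expect_sum.
rewrite (eq_bigr _ (fun x _ => expect_flip x h)).
rewrite (@eq_expect _ _ _ (fun eta => drift u (omega u ^~ eta) * h eta)
  (fun eta => n ^+ 2 * (\sum_(k < M) (u (pt M k.+1) - u (pt M k)) *
      ((omega u (pt M k) eta - omega u (pt M k.+1) eta) * h eta) +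
    \sum_(x | boundary x) (rho - u x) * (omega u x eta * h eta)))); last first.
  move=> eta; rewrite /drift -mulrA; congr (_ * _); rewrite mulrDl !mulr_suml.
  by congr (_ + _); apply: eq_bigr => x _; ring.
rewrite expectZ expectD !expect_sum.
under [X in _ = _ * (_ + X) - _]eq_bigr => x _ do rewrite expectZ.
rewrite !mulrDr addrAC; congr (_ + _); rewrite !mulr_sumr -sumrB.
apply: eq_bigr => k _; have kM := ltn_ord k.
have pp : pt M k != pt M k.+1 by rewrite pt_eq ?(ltnW kM) // neq_ltn ltnSn.
rewrite (expect_exchangeB _ _ pp) expectZ (expect_omegaB e_gt0 u_int _ pp).
rewrite (@eq_expect _ _ _ (fun eta => omega_at u k eta * omega_at u k.+1 eta * h eta)
  (fun eta => omega u (pt M k) eta * omega u (pt M k.+1) eta * h eta)).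
  by ring.
by move=> eta; rewrite /omega_at kM ltnW.
Qed.

(** Both reservoir rates are at least [e], and among the reservoir terms only that of the right end
    is kept. *)
Lemma expect_carre_ge f : e <= rho <= 1 - e ->
  e * reservoir_energy u f <= expect u (carre f).
Proof.
move=> /andP[rho1 rho2].
have e1 : e <= 1 by have /andP[h1 h2] := u_int (pt M 0); move: e_gt0 h1 h2; lra.
have rate eta x : e <= reservoir_rate eta x.
  by rewrite /reservoir_rate; case: (eta x) => /=; lra.
rewrite (eq_expect _ (carreE f)) expectZ expectD !expect_sum /reservoir_energy mulrCA.
apply: ler_wpM2l; first exact: sqr_ge0.
rewrite mulrDr; apply: lerD.
  by rewrite ler_piMl // sumr_ge0 // => k _; exact: (exchange_energy_ge0 e_gt0 u_int).
rewrite (bigD1 (pt M M)) ?boundary_right //=.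
rewrite -[leLHS]addr0; apply: lerD.
  rewrite -expectZ; apply: (ler_expect e_gt0 u_int) => eta.
  have -> : (f (flip eta (pt M M)) - f eta) ^+ 2 = site_grad (pt M M) f eta ^+ 2.
    rewrite flip_upd -[X in f _ - f X](upd_id eta (pt M M)) /site_grad.
    by case: (eta (pt M M)) => /=; ring.
  by apply: ler_wpM2r; rewrite ?sqr_ge0.
apply: sumr_ge0 => x _; apply: (expect_ge0 e_gt0 u_int) => eta.
by rewrite mulr_ge0 ?sqr_ge0 // (le_trans _ (rate _ _)) // ltW.
Qed.

End Interior.

End Generator.

(** Half of the Dirichlet form absorbs the energy produced by the quadratic form; the other half
    bounds the variance of [f] by Efron-Stein, which gives the rate [delta]. *)
Lemma chi2_dissipation (R : realType) (rho e kappa : R) :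
  0 < e -> e <= rho <= 1 - e -> 0 <= kappa ->
  exists delta C : R, [/\ 0 < delta, 0 <= C &
  forall (M : nat) (u : lattice M.+2 -> R) (f : config M.+2 -> R),
  (forall x, e <= u x <= 1 - e) ->
  (forall k, (k < M)%N -> `|u (pt M k.+1) - u (pt M k)| <= kappa / M.+2%:R) ->
  expect u f = 1 ->
  expect u (fun eta => 2 * (f eta * ssep_generator rho f eta)) -
  expect u (fun eta => drift rho u (omega u ^~ eta) * f eta ^+ 2) <=
  - delta * (expect u (fun eta => f eta ^+ 2) - 1) +
  C * (M.+2%:R * \sum_(k < M) (u (pt M k.+1) - u (pt M k)) ^+ 2) *
    expect u (fun eta => f eta ^+ 2)].
Proof.
move=> e_gt0 rho_int kappa_ge0.
have [C C0 bound] := gradient_form_bound e_gt0 kappa_ge0.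
have E0 := energy_const_gt0 kappa e_gt0.
exists (e / 2 / energy_const e kappa), C; split=> //.
  by rewrite !divr_gt0.
move=> M u f u_int u_lip f1.
pose a k := M.+2%:R ^+ 2 * (u (pt M k.+1) - u (pt M k)) ^+ 2.
have n0 : 0 < M.+2%:R :> R by rewrite ltr0n.
have a_bnd k : (k < M)%N -> 0 <= a k <= kappa ^+ 2.
  move=> kM; rewrite /a mulr_ge0 ?sqr_ge0 //= -exprMn.
  rewrite -real_normK ?num_real // lerXn2r ?nnegrE // normrM [`|M.+2%:R|]gtr0_norm //.
  by rewrite mulrC -ler_pdivlMr // u_lip.
have := bound M u f a u_int u_lip a_bnd.
have := expect_generator rho e_gt0 u_int (fun eta => f eta ^+ 2).
have := expect_carre_ge e_gt0 u_int f rho_int.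
rewrite /carre expectB.
have -> : (\sum_(x < M) a x) / M.+2%:R =
    M.+2%:R * \sum_(k < M) (u (pt M k.+1) - u (pt M k)) ^+ 2.
  rewrite /a -mulr_sumr; apply: (canLR (mulfK _)); first by rewrite gt_eqF.
  by rewrite expr2 -mulrA mulrC.
have := site_energy_le e_gt0 u_int u_lip kappa_ge0 f.
set V := expect u (fun eta => f eta ^+ 2); set S := \sum_x site_energy u f x.
have VS : V - 1 <= S by have := efron_stein e_gt0 u_int f; rewrite f1 expr1n.
set E := energy_const e kappa; set F := reservoir_energy u f.
move=> SF h1 h2 h3.
have h4 : e / 2 / E * (V - 1) <= e / 2 * F.
  rewrite -mulrA; apply: ler_wpM2l; first by rewrite divr_ge0 // ltW.
  rewrite mulrC ler_pdivrMr // mulrC; exact: le_trans VS SF.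
rewrite mulNr; move: h1 h2 h3 h4.
rewrite /a; set X1 := expect u (ssep_generator _ _); set X2 := expect u _.
set X3 := expect u _; set X4 := \sum_(k < M) _; set X5 := \sum_(k < M) _.
set X6 := _ * V; set X7 := _ * (V - 1).
clearbody X1 X2 X3 X4 X6 X7 F => h1 h2 h3 h4; lra.
Qed.

(** * Calculus *)

Section Calculus.
Variable R : realType.
Implicit Types (f g : R -> R) (t : R).

Lemma is_deriv_sum t (I : Type) (r : seq I) (F : I -> R -> R) (dF : I -> R) :
  (forall i, is_derive t 1 (F i) (dF i)) ->
  is_derive t 1 (fun s => \sum_(i <- r) F i s) (\sum_(i <- r) dF i).
Proof.
move=> dF_; elim: r => [|i r IH].
  under eq_fun do rewrite big_nil.
  rewrite big_nil; exact: is_derive_cst.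
under eq_fun do rewrite big_cons.
rewrite big_cons; exact: is_deriveD.
Qed.

Lemma is_deriv_mul t f g a b : is_derive t 1 f a -> is_derive t 1 g b ->
  is_derive t 1 (fun s => f s * g s) (a * g t + f t * b).
Proof.
move=> df dg; apply: (is_derive_eq (is_deriveM df dg)).
by rewrite /GRing.scale /= addrC mulrC.
Qed.

Lemma is_deriv_scale t c f a : is_derive t 1 f a ->
  is_derive t 1 (fun s => c * f s) (c * a).
Proof. by move=> df; exact: (is_deriveZ c df). Qed.

Lemma is_deriv_comp t f g a b : is_derive (g t) 1 f a -> is_derive t 1 g b ->
  is_derive t 1 (fun s => f (g s)) (a * b).
Proof. by move=> df dg; exact: (is_derive1_comp df dg). Qed.

Lemma is_deriv_sqr t f a : is_derive t 1 f a ->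
  is_derive t 1 (fun s => f s ^+ 2) (2 * (f t * a)).
Proof.
move=> df; apply: (is_derive_eq (is_deriv_mul df df)); ring.
Qed.

Lemma is_deriv_inv t f a : f t != 0 -> is_derive t 1 f a ->
  is_derive t 1 (fun s => (f s)^-1) (- a / f t ^+ 2).
Proof.
move=> ft0 [df fa]; apply: DeriveDef; first exact: (derivableV ft0 df).
by rewrite (deriveV ft0 df) fa /GRing.scale /= !mulNr mulrC.
Qed.

Lemma is_deriv_prod t (I : Type) (r : seq I) (F : I -> R -> R) (l : I -> R) :
  (forall i, is_derive t 1 (F i) (F i t * l i)) ->
  is_derive t 1 (fun s => \prod_(i <- r) F i s)
    ((\prod_(i <- r) F i t) * \sum_(i <- r) l i).
Proof.
move=> dF_; elim: r => [|i r IH].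
  under eq_fun do rewrite big_nil.
  rewrite !big_nil mulr0; exact: is_derive_cst.
under eq_fun do rewrite big_cons.
rewrite !big_cons; apply: (is_derive_eq (is_deriv_mul (dF_ i) IH)); ring.
Qed.

Lemma nonincreasing_from0 f (df : R -> R) :
  (forall t, 0 <= t -> is_derive t 1 f (df t)) ->
  (forall t, 0 <= t -> df t <= 0) ->
  forall t, 0 <= t -> f t <= f 0.
Proof.
move=> f_df df0 t t0.
have der x : 0 <= x -> derivable f x 1 by move=> /f_df [].
apply: (@ler0_derive1_nincry _ f 0) => //.
- by move=> x; rewrite in_itv /= andbT => /ltW/der.
- move=> x; rewrite in_itv /= andbT => /ltW x0.
  by rewrite derive1E; have [_ ->] := f_df x x0; exact: df0.
- by apply: derivable_within_continuous => x; rewrite in_itv /= andbT => /der.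
Qed.

(** Its square is differentiable, which turns a maximum principle into the monotonicity of a sum of
    squares. *)
Definition pos_part (r : R) : R := Num.max r 0.

Lemma pos_part_homo r s : r <= s -> pos_part r <= pos_part s.
Proof. by rewrite /pos_part /Num.max; case: ifP => h1; case: ifP => h2; lra. Qed.

Lemma pos_part_monotone r s : 0 <= (pos_part r - pos_part s) * (r - s).
Proof.
case: (lerP r s) => rs; first by have := pos_part_homo rs; nra.
by have := pos_part_homo (ltW rs); nra.
Qed.

Lemma is_deriv_pos_part_sqr (r : R) :
  is_derive r 1 (fun s => pos_part s ^+ 2) (2 * pos_part r).
Proof.
have lim : (fun h => h^-1 *: (((fun s => pos_part s ^+ 2) \o shift r) (h *: 1) -
    pos_part r ^+ 2)) @ 0^' --> 2 * pos_part r.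
  apply/cvgrPdist_le => eps eps0; near=> h.
  have h0 : h != 0 by near: h; exact: nbhs_dnbhs_neq.
  have he : `|h| <= eps.
    by near: h; apply: dnbhs0_le.
  apply: le_trans he; rewrite /= /GRing.scale /= mulr1.
  rewrite -(ler_pM2r (_ : 0 < `|h|)) ?normr_gt0 // -normrM -expr2 real_normK ?num_real //.
  rewrite mulrBl [h^-1 * _ * h]mulrAC mulVf // mul1r ler_norml /pos_part /Num.max.
  by case: ifP => h1; case: ifP => h2; apply/andP; split; nra.
by apply: DeriveDef; [apply/cvg_ex; exists (2 * pos_part r) | exact: cvg_lim].
Unshelve. all: by end_near. Qed.

Lemma is_deriv_pos_part_affine t f a (c K : R) : is_derive t 1 f a ->
  is_derive t 1 (fun s => pos_part (c * f s - K) ^+ 2)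
    (2 * pos_part (c * f t - K) * (c * a)).
Proof.
move=> df; have dg : is_derive t 1 (fun s => c * f s - K) (c * a).
  apply: (is_derive_eq (is_deriveB (is_deriv_scale c df) (is_derive_cst K t 1))).
  exact: subr0.
exact: (@is_deriv_comp t _ (fun s => c * f s - K) _ _ (is_deriv_pos_part_sqr _) dg).
Qed.

End Calculus.

(** * The density profile *)

Section Profile.
Variables (R : realType) (M : nat) (rho : R).
Implicit Types (u w : lattice M.+2 -> R).

(** Indexed by the true position from 0 to n, with the reservoirs as end points; the shift by one
    undoes the numbering of [pt]. *)
Definition ext_profile u (k : nat) : R :=
  if (0 < k <= M.+1)%N then u (pt M k.-1) else rho.

(** For [M = 0] the only site is coupled to the reservoir once, whereas the Laplacian would count
    both neighbours; hence the hypothesis on [M]. *)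
Lemma drift_laplacian u k : (0 < M)%N -> (k <= M)%N ->
  drift rho u (fun y => (y == pt M k)%:R) =
  M.+2%:R ^+ 2 * ((ext_profile u k.+2 - ext_profile u k.+1) -
                  (ext_profile u k.+1 - ext_profile u k)).
Proof.
move=> M0 kM; rewrite /drift; congr (_ * _).
pose d j := if (j < M)%N then u (pt M j.+1) - u (pt M j) else 0.
have d0 j : (M <= j)%N -> d j = 0 by move=> Mj; rewrite /d ltnNge Mj.
rewrite (eq_bigr (fun j : 'I_M => (k == j :> nat)%:R * d j - (k == j.+1 :> nat)%:R * d j)); last first.
  move=> j _; have jM := ltn_ord j.
  by rewrite /d jM !pt_eq ?(ltnW jM) // -mulrBl ![_ == k]eq_sym.
rewrite sumrB sum_eq_pick //.
rewrite (big_mkcond (@boundary M)) /= (bigD1 (pt M k)) //= eqxx mul1r [X in _ + (_ + X)]big1 ?addr0; last first.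
  by move=> y yk; rewrite (negbTE yk) mul0r if_same.
rewrite (_ : boundary (pt M k) = (k == 0%N) || (k == M)); last first.
  by rewrite /boundary /site pt_val.
rewrite /ext_profile /d.
case: k kM => [|k] kM.
  rewrite M0 /= big1 ?subr0 ?ltnS ?M0 /=; first by ring.
  by move=> j _; rewrite mul0r.
rewrite (eq_bigr (fun j : 'I_M => (k == j :> nat)%:R * d j)) // sum_eq_pick //.
have kM' : (k < M)%N = true by [].
rewrite /d kM' /= !ltnS kM' (ltnW kM).
case: (eqVneq k.+1 M) => [kM1|kM1].
  by rewrite kM1 ltnn /=; ring.
have -> : (k.+1 < M)%N by rewrite ltn_neqAle kM1.
by rewrite /=; ring.
Qed.

Lemma summation_by_parts (p d : nat -> R) N :
  \sum_(k < N.+1) p k * (d k.+1 - d k) =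
  p N * d N.+1 - p 0%N * d 0%N + \sum_(k < N) (p k - p k.+1) * d k.+1.
Proof.
elim: N => [|N IH]; first by rewrite big_ord1 big_ord0; ring.
by rewrite big_ord_recr /= IH [in RHS]big_ord_recr /=; ring.
Qed.

Lemma profile_poincare u :
  \sum_x (u x - rho) ^+ 2 <= M.+2%:R ^+ 2 *
    (\sum_(k < M) (u (pt M k.+1) - u (pt M k)) ^+ 2 + (u (pt M M) - rho) ^+ 2).
Proof.
pose T k := \sum_(k <= i < M) (u (pt M i.+1) - u (pt M i)) ^+ 2 + (u (pt M M) - rho) ^+ 2.
have T_ge0 k : 0 <= T k by rewrite addr_ge0 ?sqr_ge0 ?sumr_ge0 // => i _; exact: sqr_ge0.
have site j k : (k + j = M)%N -> (u (pt M k) - rho) ^+ 2 <= j.+1%:R * T k.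
  elim: j k => [|j IH] k kj.
    have -> : k = M by lia.
    by rewrite /T big_geq // add0r mul1r.
  have kM : (k < M)%N by lia.
  have := IH k.+1; rewrite addSnnS => /(_ kj).
  rewrite /T (big_ltn kM) -addrA -/(T k.+1); set g := _ - u (pt M k).
  set b := u (pt M k.+1) - rho => hb.
  have -> : u (pt M k) - rho = b - g by rewrite /b /g; ring.
  have j0 : 0 < j.+1%:R :> R by rewrite ltr0n.
  rewrite -[j.+2%:R]natr1; set c : R := j.+1%:R in j0 hb *.
  have := T_ge0 k.+1; move: hb; set Tk := T k.+1 => hb Tk0.
  (* This is the weighted Cauchy-Schwarz inequality [(b - g)^2 <= (c + 1) (b^2 / c + g^2)]
     multiplied by [c]. *)
  have h : 0 <= (b + c * g) ^+ 2 := sqr_ge0 _.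
  rewrite -(ler_pM2l j0); nra.
rewrite sum_lattice; apply: (@le_trans _ _ (\sum_(k < M.+1) M.+2%:R * T 0%N)).
  apply: ler_sum => k _; have kM : (k <= M)%N by rewrite -ltnS.
  apply: le_trans (site (M - k)%N k (subnKC kM)) _.
  apply: ler_pM => //; first by rewrite ler_nat; lia.
  rewrite /T lerD2r (big_cat_nat _ (n := k) (m := 0%N) (p := M)) //= lerDr.
  by rewrite sumr_ge0 // => i _; exact: sqr_ge0.
rewrite sumr_const card_ord -[leLHS]mulr_natl mulrA expr2 /T big_mkord.
apply: ler_wpM2r; first by have := T_ge0 0%N; rewrite /T big_mkord.
by apply: ler_wpM2r => //; rewrite ler_nat.
Qed.

End Profile.

(** * The density along the evolution and its maximum principles *)

Section Evolution.
Variables (R : realType) (M : nat) (rho : R) (m : R -> config M.+2 -> R).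
Hypothesis m_deriv : forall (t : R) eta, 0 <= t -> is_derive t 1 (m ^~ eta)
  (\sum_xi m t xi * ssep_generator rho (fun zeta => (zeta == eta)%:R) xi).
Hypothesis m_sum : forall t : R, 0 <= t -> \sum_eta m t eta = 1.

Local Notation n := (M.+2%:R : R).

Definition density (t : R) (x : lattice M.+2) : R := \sum_eta m t eta * (eta x)%:R.

Lemma deriv_observable (t : R) (h : config M.+2 -> R) : 0 <= t ->
  is_derive t 1 (fun s => \sum_eta m s eta * h eta)
    (\sum_eta m t eta * ssep_generator rho h eta).
Proof.
move=> t0; apply: (is_derive_eq (is_deriv_sum _ (fun eta =>
  is_deriv_mul (m_deriv eta t0) (is_derive_cst (h eta) t 1)))).
under eq_bigr => eta _ do rewrite mulr0 addr0 mulr_suml.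
rewrite exchange_big; apply: eq_bigr => xi _ /=.
rewrite [in RHS]generator_delta mulr_sumr; apply: eq_bigr => eta _.
by rewrite -mulrA; congr (_ * _); exact: mulrC.
Qed.

Lemma drift_density (t : R) w : 0 <= t ->
  \sum_eta m t eta * drift rho (fun x => (eta x)%:R) w = drift rho (density t) w.
Proof.
move=> t0; rewrite /drift; under eq_bigr => eta _ do rewrite mulrCA mulrDr.
rewrite -mulr_sumr big_split /=; congr (_ * (_ + _)).
  under eq_bigr => eta _ do rewrite mulr_sumr.
  rewrite exchange_big; apply: eq_bigr => k _ /=.
  rewrite /density -sumrB mulr_sumr; apply: eq_bigr => eta _; ring.
under eq_bigr => eta _ do rewrite mulr_sumr.
rewrite exchange_big; apply: eq_bigr => x _ /=.
have rhoE : rho = \sum_eta m t eta * rho by rewrite -mulr_suml m_sum // mul1r.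
rewrite [X in _ * (X - _)]rhoE /density -sumrB mulr_sumr.
by apply: eq_bigr => eta _; ring.
Qed.

(** The generator maps linear functions of the occupations to affine ones, so the density solves a
    closed equation. *)
Lemma deriv_density (t : R) x : 0 <= t ->
  is_derive t 1 (density ^~ x) (drift rho (density t) (fun y => (y == x)%:R)).
Proof.
move=> t0; rewrite -drift_density //.
have E : (fun xi : config M.+2 => (xi x)%:R) = (fun xi => \sum_y (y == x)%:R * (xi y)%:R) :> (_ -> R).
  apply/funext => xi; rewrite (bigD1 x) //= eqxx mul1r big1 ?addr0 // => y /negbTE ->.
  by rewrite mul0r.
apply: (is_derive_eq (deriv_observable _ t0)); apply: eq_bigr => eta _.
by rewrite E generator_linear.
Qed.

(** The squared excess of [s * density] over [K] vanishes at time 0 and never grows: a bond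
    contributes with a sign because the positive part is monotone, the reservoirs because
    [s * rho <= K]. The signs [s = 1] and [s = -1] give the two bounds. *)
Lemma density_max (s K : R) : s * rho <= K -> (forall x, s * density 0 x <= K) ->
  forall (t : R) x, 0 <= t -> s * density t x <= K.
Proof.
move=> rhoK initK t x t0.
pose p (t : R) x := pos_part (s * density t x - K).
pose phi (t : R) := \sum_x p t x ^+ 2.
have dphi (r : R) : 0 <= r -> is_derive r 1 phi (2 * s * drift rho (density r) (p r)).
  move=> r0; apply: (is_derive_eq (is_deriv_sum _ (fun y =>
    is_deriv_pos_part_affine s K (deriv_density y r0)))).
  rewrite [in RHS]drift_sum mulr_sumr; apply: eq_bigr => y _.
  by rewrite /p; ring.
have dphi_le0 (r : R) : 0 <= r -> 2 * s * drift rho (density r) (p r) <= 0.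
  move=> r0; rewrite /drift; set A := \sum_(k < M) _; set B := \sum_(x | _) _.
  have -> : 2 * s * (n ^+ 2 * (A + B)) = 2 * n ^+ 2 * (s * A + s * B) by ring.
  rewrite mulr_ge0_le0 ?mulr_ge0 ?sqr_ge0 // -[leRHS]addr0; apply: lerD.
    rewrite mulr_sumr; apply: sumr_le0 => k _.
    have := pos_part_monotone (s * density r (pt M k) - K) (s * density r (pt M k.+1) - K).
    by rewrite /p; lra.
  rewrite mulr_sumr; apply: sumr_le0 => y _; rewrite /p /pos_part /Num.max.
  case: ifP => [_|/negbT]; first by rewrite mul0r mulr0.
  by rewrite -leNgt => h; nra.
have phi_t : phi t <= 0.
  apply: le_trans (nonincreasing_from0 dphi dphi_le0 t0) _.
  rewrite /phi big1 // => y _; rewrite /p /pos_part max_r ?expr0n //.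
  by rewrite subr_le0.
have : p t x ^+ 2 <= 0.
  apply: le_trans phi_t; rewrite /phi (bigD1 x) //= lerDl sumr_ge0 // => y _.
  exact: sqr_ge0.
rewrite le_eqVlt ltNge sqr_ge0 orbF sqrf_eq0 /p /pos_part => /eqP h.
by rewrite -subr_le0 -h le_max lexx.
Qed.

(** The discrete gradient, including the differences to the reservoirs, solves the heat equation
    without flux at the ends, so the maximum principle applies to it as well. *)
Lemma density_gradient_max (s K : R) : (0 < M)%N ->
  let g (t : R) k := ext_profile rho (density t) k.+1 - ext_profile rho (density t) k in
  (forall k, (k <= M.+1)%N -> s * g 0 k <= K) ->
  forall (t : R) k, 0 <= t -> (k <= M.+1)%N -> s * g t k <= K.
Proof.
move=> M0 g initK t k t0 kM.
(* The time derivative of the extended profile; it is zero at both reservoirs, which removes the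
   boundary terms in the summation by parts. *)
pose U' (t : R) (k : nat) := if (0 < k <= M.+1)%N then n ^+ 2 * (g t k - g t k.-1) else 0.
pose p (t : R) (k : nat) := pos_part (s * g t k - K).
pose phi (t : R) := \sum_(k < M.+2) p t k ^+ 2.
have dU (r : R) j : 0 <= r -> is_derive r 1 (fun t => ext_profile rho (density t) j) (U' r j).
  move=> r0; rewrite /ext_profile /U'; case: ifP => [|_]; last exact: is_derive_cst.
  case: j => // j jM; apply: (is_derive_eq (deriv_density _ r0)).
  by rewrite drift_laplacian.
have dphi (r : R) : 0 <= r -> is_derive r 1 phi (2 * s * \sum_(k < M.+2) p r k * (U' r k.+1 - U' r k)).
  move=> r0; apply: (is_derive_eq (is_deriv_sum _ (fun j : 'I_M.+2 =>
    is_deriv_pos_part_affine s K (is_deriveB (dU r j.+1 r0) (dU r j r0))))).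
  rewrite mulr_sumr; apply: eq_bigr => y _.
  by rewrite /p; ring.
have dphi_le0 (r : R) : 0 <= r -> 2 * s * \sum_(k < M.+2) p r k * (U' r k.+1 - U' r k) <= 0.
  move=> r0; rewrite summation_by_parts.
  rewrite [U' r M.+2]/U' ltnn andbF [U' r 0%N]/U' !mulr0 subr0 add0r mulr_sumr.
  apply: sumr_le0 => j _; rewrite /U' /= ltn_ord.
  have := pos_part_monotone (s * g r j - K) (s * g r j.+1 - K); rewrite -/(p r j) -/(p r j.+1) => h.
  have -> : 2 * s * ((p r j - p r j.+1) * (n ^+ 2 * (g r j.+1 - g r j))) =
    - (2 * n ^+ 2 * ((p r j - p r j.+1) * (s * g r j - K - (s * g r j.+1 - K)))) by ring.
  by rewrite oppr_le0 mulr_ge0 // mulr_ge0 ?sqr_ge0.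
have phi_t : phi t <= 0.
  apply: le_trans (nonincreasing_from0 dphi dphi_le0 t0) _.
  rewrite /phi big1 // => y _; rewrite /p /pos_part max_r ?expr0n //.
  by rewrite subr_le0 initK // -ltnS.
have : p t k ^+ 2 <= 0.
  apply: le_trans phi_t; have kM' : (k < M.+2)%N by [].
  rewrite /phi (bigD1 (Ordinal kM')) //= lerDl sumr_ge0 // => y _.
  exact: sqr_ge0.
rewrite le_eqVlt ltNge sqr_ge0 orbF sqrf_eq0 /p /pos_part => /eqP h.
by rewrite -subr_le0 -h le_max lexx.
Qed.

End Evolution.

(** * The Lyapunov function *)

Section Lyapunov.
Variables (R : realType) (M : nat) (rho e kappa : R).
Variables (m : R -> config M.+2 -> R) (u0 : lattice M.+2 -> R).
Hypothesis e_gt0 : 0 < e.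
Hypothesis rho_int : e <= rho <= 1 - e.
Hypothesis kappa_ge0 : 0 <= kappa.
Hypothesis m_deriv : forall (t : R) eta, 0 <= t -> is_derive t 1 (m ^~ eta)
  (\sum_xi m t xi * ssep_generator rho (fun zeta => (zeta == eta)%:R) xi).
Hypothesis m_sum : forall t : R, 0 <= t -> \sum_eta m t eta = 1.
Hypothesis m_init : m 0 =1 bernoulli_product u0.
Hypothesis u0_int : forall x, e <= u0 x <= 1 - e.
Hypothesis u0_lip : forall k, (k <= M.+1)%N ->
  `|ext_profile rho u0 k.+1 - ext_profile rho u0 k| <= kappa / M.+2%:R.

Local Notation n := (M.+2%:R : R).
Local Notation u := (density m).

Let n_gt0 : 0 < n. Proof. by rewrite ltr0n. Qed.

Lemma density_init x : u 0 x = u0 x.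
Proof.
rewrite /density (eq_bigr (fun eta => bernoulli_product u0 eta * (eta x)%:R)).
  rewrite -/(expect u0 _) (expect_site u0 x) -[RHS](expect_cst u0).
  by apply: eq_expect => eta; rewrite !upd_same /= mulr1 mulr0 addr0.
by move=> eta _; rewrite m_init.
Qed.

Lemma density_interior (t : R) x : 0 <= t -> e <= u t x <= 1 - e.
Proof.
move=> t0; have /andP[r1 r2] := rho_int; apply/andP; split.
  rewrite -lerN2 -[leLHS]mulN1r; apply: (density_max m_deriv m_sum) => // [|y].
    by rewrite mulN1r lerN2.
  by rewrite density_init mulN1r lerN2; have /andP[] := u0_int y.
rewrite -[leLHS]mul1r; apply: (density_max m_deriv m_sum) => // [|y].
  by rewrite mul1r.
by rewrite mul1r density_init; have /andP[] := u0_int y.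
Qed.

Lemma density_lipschitz (t : R) k : 0 <= t -> (k < M)%N ->
  `|u t (pt M k.+1) - u t (pt M k)| <= kappa / n.
Proof.
move=> t0 kM; have M0 : (0 < M)%N by exact: leq_ltn_trans kM.
have -> : u t (pt M k.+1) - u t (pt M k) =
    ext_profile rho (u t) k.+2 - ext_profile rho (u t) k.+1.
  by rewrite /ext_profile /= ltnS kM ltnS ltnW.
have ext0 j : ext_profile rho (u 0) j = ext_profile rho u0 j.
  by rewrite /ext_profile; case: ifP => // _; rewrite density_init.
have k1 : (k.+1 <= M.+1)%N by rewrite ltnS ltnW.
rewrite ler_norml; apply/andP; split.
  rewrite -lerN2 opprK -[leLHS]mulN1r.
  apply: (density_gradient_max m_deriv m_sum) => // j jM.
  have := u0_lip jM; rewrite !ext0 ler_norml => /andP[h _].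
  by rewrite mulN1r -lerN2 opprK.
rewrite -[leLHS]mul1r.
apply: (density_gradient_max m_deriv m_sum) => // j jM.
by have := u0_lip jM; rewrite !ext0 ler_norml mul1r => /andP[].
Qed.

(** The integral of the squared density, that is, one plus the chi-square distance. *)
Definition chi2 (t : R) := \sum_eta m t eta ^+ 2 / bernoulli_product (u t) eta.

Let f (t : R) eta := m t eta / bernoulli_product (u t) eta.

Let nu_gt0 (t : R) eta : 0 <= t -> 0 < bernoulli_product (u t) eta.
Proof.
by move=> t0; apply: (bernoulli_gt0 e_gt0 (fun x => density_interior x t0)).
Qed.

Let mE (t : R) eta : 0 <= t -> m t eta = bernoulli_product (u t) eta * f t eta.
Proof. by move=> t0; rewrite /f mulrC divfK // gt_eqF // nu_gt0. Qed.

Lemma chi2E (t : R) : 0 <= t -> chi2 t = expect (u t) (fun eta => f t eta ^+ 2).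
Proof.
move=> t0; apply: eq_bigr => eta _; rewrite /f.
by field; rewrite gt_eqF // nu_gt0.
Qed.

Let expect_f (t : R) : 0 <= t -> expect (u t) (f t) = 1.
Proof.
by move=> t0; rewrite -(m_sum t0); apply: eq_bigr => eta _; rewrite mE.
Qed.

Lemma chi2_ge1 (t : R) : 0 <= t -> 1 <= chi2 t.
Proof.
move=> t0; rewrite chi2E //.
have : 0 <= expect (u t) (fun eta => (f t eta - 1) ^+ 2).
  apply: (expect_ge0 e_gt0 (fun x => density_interior x t0)) => eta.
  exact: sqr_ge0.
rewrite (@eq_expect _ _ _ _ (fun eta => f t eta ^+ 2 - (2 * f t eta - 1))).
  by rewrite !expectB expectZ expect_cst expect_f //; lra.
by move=> eta; ring.
Qed.

(** Each factor has logarithmic derivative [omega u x] times the derivative of [u x], and these add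
    up to a [drift] with weight [omega]. *)
Let deriv_bernoulli (t : R) eta : 0 <= t ->
  is_derive t 1 (fun s => bernoulli_product (u s) eta)
   (bernoulli_product (u t) eta * drift rho (u t) (omega (u t) ^~ eta)).
Proof.
move=> t0; rewrite drift_sum; apply: is_deriv_prod => x.
have du := deriv_density m_deriv m_sum x t0.
have := density_interior x t0; set v := u t x; move=> /andP[v1 v2].
have v0 : 0 < v by exact: lt_le_trans v1.
have v3 : 0 < 1 - v by move: e_gt0 v2; lra.
set D := drift _ _ _ in du *.
have d1 := is_deriv_scale (eta x)%:R du.
have d2 := is_deriv_scale (1 - (eta x)%:R) (is_deriveB (is_derive_cst (1 : R) t 1) du).
apply: (is_derive_eq (is_deriveD d1 d2)).
rewrite -/v /omega -/v; case: (eta x) => /=; field; rewrite !gt_eqF //.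
Qed.

Lemma deriv_chi2 (t : R) : 0 <= t ->
  is_derive t 1 chi2
   (expect (u t) (fun eta => 2 * (f t eta * ssep_generator rho (f t) eta)) -
    expect (u t) (fun eta => drift rho (u t) (omega (u t) ^~ eta) * f t eta ^+ 2)).
Proof.
move=> t0; have nun0 eta : bernoulli_product (u t) eta != 0 by rewrite gt_eqF // nu_gt0.
apply: (is_derive_eq (is_deriv_sum _ (fun eta => is_deriv_mul
  (is_deriv_sqr (m_deriv eta t0)) (is_deriv_inv (nun0 eta) (deriv_bernoulli eta t0))))).
rewrite big_split /=; congr (_ + _); last first.
  rewrite -sumrN; apply: eq_bigr => eta _; rewrite /f; field; exact: nun0.
rewrite (eq_bigr (fun eta => \sum_xi 2 * m t xi * (f t eta *
   ssep_generator rho (fun zeta => (zeta == eta)%:R) xi))); last first.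
  move=> eta _; rewrite !mulr_sumr mulr_suml; apply: eq_bigr => xi _.
  by rewrite /f; ring.
rewrite exchange_big; apply: eq_bigr => xi _ /=.
by rewrite -mulr_sumr -generator_delta mE //; ring.
Qed.

Definition profile_energy (t : R) := \sum_x (u t x - rho) ^+ 2.

Lemma deriv_profile_energy (t : R) : 0 <= t ->
  is_derive t 1 profile_energy (2 * drift rho (u t) (fun x => u t x - rho)).
Proof.
move=> t0; apply: (is_derive_eq (is_deriv_sum _ (fun x => is_deriv_sqr
   (is_deriveB (deriv_density m_deriv m_sum x t0) (is_derive_cst rho t 1))))).
rewrite [in RHS]drift_sum mulr_sumr; apply: eq_bigr => x _.
by rewrite subr0.
Qed.

(** The factor 2 splits the dissipation: one half beats the energy itself by the Poincaré
    inequality, giving decay at rate 1, and the other half remains to dominate the squared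
    gradients. *)
Lemma profile_dissipation (t : R) : 0 <= t ->
  profile_energy t + 2 * drift rho (u t) (fun x => u t x - rho) <=
  - n ^+ 2 * \sum_(k < M) (u t (pt M k.+1) - u t (pt M k)) ^+ 2.
Proof.
move=> t0; have := profile_poincare rho (u t); rewrite -/(profile_energy t).
rewrite /drift (bigD1 (pt M M)) ?boundary_right //=.
set G := \sum_(k < M) (u t _ - _) ^+ 2; set B := \sum_(x | boundary x && _) _.
have -> : \sum_(k < M) (u t (pt M k) - rho - (u t (pt M k.+1) - rho)) *
    (u t (pt M k.+1) - u t (pt M k)) = - G.
  by rewrite /G -sumrN; apply: eq_bigr => k _; ring.
have B0 : B <= 0 by apply: sumr_le0 => x _; have := sqr_ge0 (u t x - rho); nra.
set b := u t (pt M M) - rho; have -> : rho - u t (pt M M) = - b by rewrite opprB.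
move=> h; have := mulr_ge0_le0 (sqr_ge0 n) B0; have := mulr_ge0 (sqr_ge0 n) (sqr_ge0 b).
by move: h; set N := n ^+ 2 => h1 h2 h3; lra.
Qed.

Lemma chi2_bound (delta C : R) : 0 <= delta <= 1 -> 0 <= C ->
  (forall t : R, 0 <= t ->
    expect (u t) (fun eta => 2 * (f t eta * ssep_generator rho (f t) eta)) -
    expect (u t) (fun eta => drift rho (u t) (omega (u t) ^~ eta) * f t eta ^+ 2) <=
    - delta * (chi2 t - 1) +
    C * (n * \sum_(k < M) (u t (pt M k.+1) - u t (pt M k)) ^+ 2) * chi2 t) ->
  forall t : R, 0 <= t -> chi2 t - 1 <= expR C * expR (- (delta * t)).
Proof.
move=> /andP[d0 d1] C0 diss t t0.
pose E (s : R) := expR (delta * s).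
pose Y (s : R) := C / n * (E s * profile_energy s).
(* The error [C a G] also contains the inhomogeneous part [C a]. Adding 1 makes the inequality
   homogeneous, because [E s >= 1]: the derivative of [1 + E (G - 1)] is at most [C E a] times
   itself, and the factor [expR Y] compensates this. *)
pose Z (s : R) := (1 + E s * (chi2 s - 1)) * expR (Y s).
pose G' (s : R) := expect (u s) (fun eta => 2 * (f s eta * ssep_generator rho (f s) eta)) -
    expect (u s) (fun eta => drift rho (u s) (omega (u s) ^~ eta) * f s eta ^+ 2).
pose P' (s : R) := 2 * drift rho (u s) (fun x => u s x - rho).
pose Y' (s : R) := C / n * (E s * delta * profile_energy s + E s * P' s).
pose Z' (s : R) := (E s * delta * (chi2 s - 1) + E s * G' s) * expR (Y s) +
   (1 + E s * (chi2 s - 1)) * (expR (Y s) * Y' s).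
have dE (s : R) : is_derive s 1 E (E s * delta).
  apply: (@is_deriv_comp _ s expR (fun r => delta * r) _ _ (is_derive_expR _)).
  by apply: (is_derive_eq (is_deriv_scale delta (is_derive_id s 1))); rewrite mulr1.
have dY (s : R) : 0 <= s -> is_derive s 1 Y (Y' s).
  by move=> s0; apply: is_deriv_scale; apply: is_deriv_mul => //; exact: deriv_profile_energy.
have dZ (s : R) : 0 <= s -> is_derive s 1 Z (Z' s).
  move=> s0; apply: is_deriv_mul.
    apply: (is_derive_eq (is_deriveD (is_derive_cst (1 : R) s 1)
      (is_deriv_mul (dE s) (is_deriveB (deriv_chi2 s0) (is_derive_cst (1 : R) s 1))))).
    by rewrite add0r subr0.
  exact: (@is_deriv_comp _ s expR Y _ _ (is_derive_expR _) (dY s s0)).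
have E_gt0 (s : R) : 0 < E s by exact: expR_gt0.
have E_ge1 (s : R) : 0 <= s -> 1 <= E s.
  by move=> s0; rewrite -expR0 ler_expR mulr_ge0.
have dZ_le0 (s : R) : 0 <= s -> Z' s <= 0.
  move=> s0; rewrite /Z'; set V := chi2 s - 1.
  rewrite [leLHS](_ : _ = (E s * (delta * V + G' s) + (1 + E s * V) * Y' s) * expR (Y s)); last by ring.
  rewrite mulr_le0_ge0 ?expR_ge0 //.
  set A := n * \sum_(k < M) (u s (pt M k.+1) - u s (pt M k)) ^+ 2.
  have A0 : 0 <= A by rewrite mulr_ge0 // sumr_ge0 // => k _; exact: sqr_ge0.
  have V0 : 0 <= V by rewrite subr_ge0 chi2_ge1.
  have h1 : delta * V + G' s <= C * A * (1 + V).
    by have := diss s s0; rewrite -/(G' s) -/A -/V /V; lra.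
  have h2 : Y' s <= - (C * (E s * A)).
    have pe0 : 0 <= profile_energy s by rewrite sumr_ge0 // => x _; exact: sqr_ge0.
    have h : delta * profile_energy s + P' s <= - n * A.
      apply: le_trans (lerD (ler_wpM2r pe0 d1) (lexx _)) _; rewrite mul1r.
      apply: le_trans (profile_dissipation s0) _.
      by rewrite /A expr2 !mulNr mulrA.
    rewrite /Y' [leLHS](_ : _ = C / n * E s * (delta * profile_energy s + P' s)); last by ring.
    have CE : 0 <= C / n * E s by rewrite mulr_ge0 ?divr_ge0 // ltW.
    apply: le_trans (ler_wpM2l CE h) _.
    by rewrite le_eqVlt; apply/orP; left; apply/eqP; field; rewrite gt_eqF.
  have Es := E_ge1 s s0.
  have EV : V <= E s * V by rewrite ler_peMl.
  have EV1 : 0 <= 1 + E s * V by rewrite addr_ge0 // mulr_ge0 // ltW.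
  have CEA : 0 <= C * (E s * A) by rewrite mulr_ge0 // mulr_ge0 // ltW.
  apply: (@le_trans _ _ (E s * (C * A * (1 + V)) + (1 + E s * V) * - (C * (E s * A)))).
    by apply: lerD; apply: ler_wpM2l => //; exact: ltW.
  rewrite [leLHS](_ : _ = C * (E s * A) * (V - E s * V)); last by ring.
  by rewrite mulr_ge0_le0 // subr_le0.
have Zt := nonincreasing_from0 dZ dZ_le0 t0.
(* The chain starts from the reference measure itself. *)
have chi20 : chi2 0 = 1.
  rewrite -(m_sum (lexx 0)); apply: eq_bigr => eta _.
  have -> : u 0 = u0 by apply/funext => x; rewrite density_init.
  rewrite m_init expr2 mulfK // gt_eqF //.
  exact: (bernoulli_gt0 e_gt0 u0_int).
have E0 : E 0 = 1 by rewrite /E mulr0 expR0.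
(* The profile energy has fewer than [n] terms, each at most 1, so the division by [n] makes the
   constant uniform in the size of the lattice. *)
have Z0 : Z 0 <= expR C.
  rewrite /Z chi20 subrr mulr0 addr0 mul1r ler_expR /Y E0 mul1r -[leRHS]mulr1 -mulrA.
  apply: ler_wpM2l => //; rewrite mulrC ler_pdivrMr // mul1r.
  apply: (@le_trans _ _ (\sum_(x : lattice M.+2) 1)).
    apply: ler_sum => x _; have /andP[a1 a2] := density_interior x (lexx 0).
    by have /andP[b1 b2] := rho_int; move: e_gt0 => e0; nra.
  by rewrite sumr_const card_ord -[leLHS]mulr_natl mulr1 ler_nat.
have V0 : 0 <= chi2 t - 1 by rewrite subr_ge0 chi2_ge1.
have EV1 : 0 <= 1 + E t * (chi2 t - 1) by rewrite addr_ge0 // mulr_ge0 // ltW.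
have Y0 : 1 <= expR (Y t).
  rewrite -expR0 ler_expR mulr_ge0 ?divr_ge0 // ?(ltW n_gt0) // mulr_ge0 ?(ltW (E_gt0 t)) //.
  by rewrite sumr_ge0 // => x _; exact: sqr_ge0.
have : E t * (chi2 t - 1) <= expR C.
  apply: le_trans Z0; apply: le_trans Zt; rewrite /Z.
  by apply: le_trans (ler_peMr EV1 Y0); rewrite lerDr.
by rewrite expRN -ler_pdivlMl // mulrC.
Qed.

End Lyapunov.

Lemma chi2_decay (R : realType) (rho e kappa : R) :
  0 < e -> e <= rho <= 1 - e -> 0 <= kappa ->
  exists C delta : R, 0 < delta /\
  forall (M : nat) (m : R -> config M.+2 -> R) (u0 : lattice M.+2 -> R),
  (forall (t : R) eta, 0 <= t -> is_derive t 1 (m ^~ eta)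
    (\sum_xi m t xi * ssep_generator rho (fun zeta => (zeta == eta)%:R) xi)) ->
  (forall t : R, 0 <= t -> \sum_eta m t eta = 1) ->
  m 0 =1 bernoulli_product u0 ->
  (forall x, e <= u0 x <= 1 - e) ->
  (forall k, (k <= M.+1)%N ->
    `|ext_profile rho u0 k.+1 - ext_profile rho u0 k| <= kappa / M.+2%:R) ->
  forall t : R, 0 <= t -> chi2 m t - 1 <= C * expR (- (delta * t)).
Proof.
move=> e_gt0 rho_int kappa_ge0.
have [delta [C [d0 C0 diss]]] := chi2_dissipation e_gt0 rho_int kappa_ge0.
(* The rate is capped at 1, the decay rate of the profile energy. *)
exists (expR C), (Num.min delta 1); split; first by rewrite lt_min d0 ltr01.
move=> M m u0 m_deriv m_sum m_init u0_int u0_lip.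
apply: (chi2_bound e_gt0 rho_int m_deriv m_sum m_init u0_int) => //.
  by rewrite le_min (ltW d0) ler01 ge_min lexx orbT.
move=> s s0; have uint x := density_interior rho_int m_deriv m_sum m_init u0_int x s0.
have ulip k := @density_lipschitz _ _ _ _ _ _ m_deriv m_sum m_init u0_lip s k s0.
have chiE := chi2E e_gt0 rho_int m_deriv m_sum m_init u0_int s0; rewrite /= in chiE.
rewrite chiE.
apply: le_trans (diss M (density m s) _ uint ulip _) _.
  rewrite -(m_sum s s0); apply: eq_bigr => eta _.
  by rewrite mulrC divfK // gt_eqF // (bernoulli_gt0 e_gt0 uint).
rewrite lerD2r !mulNr lerN2 ler_wpM2r ?ge_min ?lexx //.
have := chi2_ge1 e_gt0 rho_int m_deriv m_sum m_init u0_int s0; rewrite chiE.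
by rewrite subr_ge0.
Qed.

(** * From the Markov chain to the forward equation *)

Section FiniteRV.
Variables (R : realType) (n : nat) (d : measure_display) (T : measurableType d).
Variables (P : probability T R).

Lemma measurable_preimage (Y : {RV P >-> config n}) (A : set (config n)) :
  measurable (Y @^-1` A).
Proof. by rewrite -[_ @^-1` _]setTI; apply: measurable_funP. Qed.

Lemma probability_partition (Y : {RV P >-> config n}) (C : set T) :
  measurable C ->
  fine (P C) = \sum_eta fine (P (C `&` Y @^-1` [set eta])).
Proof.
move=> mC.
have mCY eta : measurable (C `&` Y @^-1` [set eta]).
  by apply: measurableI => //; exact: measurable_preimage.
have EC : C = \bigcup_(eta in [set` index_enum (config n)]) (C `&` Y @^-1` [set eta]).
  apply/seteqP; split=> [w Cw|w [eta _ []] //].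
  by exists (Y w) => //=; exact: mem_index_enum.
rewrite [in LHS]EC measure_fin_bigcup //; first last.
- by move=> i j _ _ [w [[_ /= <-] [_ /= <-]]].
rewrite -fsbig_seq ?index_enum_uniq // -sum_fine //.
by move=> eta _; exact: fin_num_measure.
Qed.

Variable X : R -> {RV P >-> config n}.

Lemma lawE t eta : law X t eta = fine (P (X t @^-1` [set eta])).
Proof. by []. Qed.

Lemma mean_densityE t x :
  mean_density X t x = \sum_eta law X t eta * (eta x)%:R.
Proof.
rewrite /mean_density.
have -> : (fun w => (X t w x)%:R) = \1_(X t @^-1` [set eta : config n | eta x]) :> (T -> R).
  apply/funext => w; rewrite indicE; congr (_%:R); congr nat_of_bool.
  by apply/idP/idP => [h|]; rewrite ?inE.
rewrite expectation_indic; last exact: measurable_preimage.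
rewrite (probability_partition (X t)); last exact: measurable_preimage.
apply: eq_bigr => eta _; rewrite lawE; case etax: (eta x).
  rewrite mulr1; congr (fine (P _)); apply/seteqP; split=> [w []//|w /= ->//].
rewrite mulr0 (_ : _ `&` _ = set0) ?measure0 //.
by apply/seteqP; split=> // w [/= + Xw]; rewrite Xw etax.
Qed.

End FiniteRV.

Lemma cvg_fin_sum (R : realType) (I : finType) (F : set_system R) (FF : Filter F)
    (f : I -> R -> R) (l : I -> R) :
  (forall i, f i x @[x --> F] --> l i) ->
  \sum_i f i x @[x --> F] --> \sum_i l i.
Proof. by move=> fl; apply: cvg_big => //; exact: add_continuous. Qed.

(** * Differentiability of the law in time *)

Section Forward.
Variables (R : realType) (M : nat) (rho : R).
Variables (p : R -> config M.+2 -> config M.+2 -> R) (nu : config M.+2 -> R).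
Hypothesis p_trans : transition_function p.
Hypothesis p_gen : has_generator p (@ssep_generator R rho M.+2).
Hypothesis nu_ge0 : forall eta, 0 <= nu eta.
Hypothesis nu_sum : \sum_eta nu eta = 1.

Let p_ge0 (t : R) eta xi : 0 <= t -> 0 <= p t eta xi.
Proof. by case: p_trans => h _ _ _; exact: h. Qed.

Let p_sum (t : R) eta : 0 <= t -> \sum_xi p t eta xi = 1.
Proof. by case: p_trans => _ h _ _; exact: h. Qed.

Let p0 eta xi : p 0 eta xi = (eta == xi)%:R.
Proof. by case: p_trans. Qed.

Let pD (s t : R) eta xi : 0 <= s -> 0 <= t ->
  p (s + t) eta xi = \sum_zeta p s eta zeta * p t zeta xi.
Proof. by case: p_trans => _ _ _; exact. Qed.

Definition evolve (t : R) eta : R := \sum_xi nu xi * p t xi eta.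

Lemma evolve0 eta : evolve 0 eta = nu eta.
Proof.
rewrite /evolve (bigD1 eta) //= p0 eqxx mulr1 big1 ?addr0 // => xi xe.
by rewrite p0 (negbTE xe) mulr0.
Qed.

Lemma evolve_ge0 (t : R) eta : 0 <= t -> 0 <= evolve t eta.
Proof. by move=> t0; apply: sumr_ge0 => xi _; rewrite mulr_ge0 ?p_ge0. Qed.

Lemma evolve_sum (t : R) : 0 <= t -> \sum_eta evolve t eta = 1.
Proof.
move=> t0; rewrite /evolve exchange_big /= -nu_sum; apply: eq_bigr => xi _.
by rewrite -mulr_sumr p_sum // mulr1.
Qed.

Let evolve_le1 (t : R) eta : 0 <= t -> evolve t eta <= 1.
Proof.
move=> t0; rewrite -(evolve_sum t0) (bigD1 eta) //= lerDl sumr_ge0 // => xi _.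
exact: evolve_ge0.
Qed.

Lemma evolveD (s t : R) eta : 0 <= s -> 0 <= t ->
  evolve (s + t) eta = \sum_zeta evolve s zeta * p t zeta eta.
Proof.
move=> s0 t0; rewrite /evolve; under eq_bigr => xi _ do rewrite pD // mulr_sumr.
rewrite exchange_big; apply: eq_bigr => zeta _ /=.
by rewrite mulr_suml; apply: eq_bigr => xi _; rewrite mulrA.
Qed.

Let rate (eta zeta : config M.+2) : R := ssep_generator rho (fun xi => (xi == eta)%:R) zeta.

Let quot (eta : config M.+2) (h : R) zeta : R := (p h zeta eta - (zeta == eta)%:R) / h.

Let quot_cvg eta zeta : quot eta h zeta @[h --> 0^'+] --> rate eta zeta.
Proof.
have := @p_gen (fun xi => (xi == eta)%:R) zeta.
rewrite (_ : (fun h => (\sum_xi p h zeta xi * (xi == eta)%:R - (zeta == eta)%:R) / h) = quot eta ^~ zeta) //.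
apply/funext => h; rewrite /quot (bigD1 eta) //= eqxx mulr1 big1 ?addr0 // => xi xe.
by rewrite (negbTE xe) mulr0.
Qed.

Let p_cvg eta zeta : p h zeta eta - (zeta == eta)%:R @[h --> 0^'+] --> (0 : R).
Proof.
have idc : h @[h --> (0 : R)^'+] --> (0 : R).
  by apply: cvg_within_filter; exact: cvg_id.
have : quot eta h zeta * h @[h --> (0 : R)^'+] --> (0 : R).
  by rewrite -[X in _ --> X](mulr0 (rate eta zeta)); exact: cvgM.
apply: cvg_trans; apply: near_eq_cvg; near=> h.
have h0 : 0 < h by near: h; exact: nbhs_right_gt.
by rewrite /quot /= divfK // gt_eqF.
Unshelve. all: by end_near. Qed.

Let increment (t h : R) eta : 0 <= t -> 0 <= h ->
  evolve (t + h) eta - evolve t eta = \sum_zeta evolve t zeta * (p h zeta eta - (zeta == eta)%:R).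
Proof.
move=> t0 h0; rewrite evolveD //; under [RHS]eq_bigr => zeta _ do rewrite mulrBr.
rewrite sumrB; congr (_ - _).
rewrite (bigD1 eta) //= eqxx mulr1 big1 ?addr0 // => xi xe.
by rewrite (negbTE xe) mulr0.
Qed.

(** The increment over [[t - h, t]] is bounded by entries of [p h] alone, since the law at time
    [t - h] is at most 1. This continuity is what the left derivative needs, the generator being a
    right derivative at time 0. *)
Let evolve_left_cvg (t : R) eta : 0 < t -> evolve (t - h) eta @[h --> 0^'+] --> evolve t eta.
Proof.
move=> t0; apply/cvgrPdist_le => eps eps0.
have small : \sum_zeta `|p h zeta eta - (zeta == eta)%:R| @[h --> 0^'+] --> (0 : R).
  rewrite -[X in _ --> X](@big1 R 0 +%R (config M.+2) (index_enum _) xpredT (fun=> 0)) //.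
  apply: cvg_fin_sum => zeta; rewrite -[X in _ --> X](normr0 R).
  by apply: cvg_norm; exact: p_cvg.
near=> h.
have h0 : 0 < h by near: h; exact: nbhs_right_gt.
have ht : h < t by near: h; exact: nbhs_right_lt.
have th : 0 <= t - h by rewrite subr_ge0 ltW.
have hs : \sum_zeta `|p h zeta eta - (zeta == eta)%:R| <= eps.
  have : `|0 - \sum_zeta `|p h zeta eta - (zeta == eta)%:R| | <= eps.
    by near: h; move/cvgrPdist_le : small; exact.
  by rewrite sub0r normrN; exact: le_trans (ler_norm _).
apply: le_trans hs; have := increment eta th (ltW h0); rewrite subrK => ->.
apply: le_trans (ler_norm_sum _ _ _) _; apply: ler_sum => zeta _.
by rewrite normrM ger0_norm ?evolve_ge0 // ler_piMl // evolve_le1.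
Unshelve. all: by end_near. Qed.

(* The evolution is continued linearly to negative times, so that it is
   differentiable at time [0] as well. *)
Definition extended_evolve (t : R) eta : R :=
  if 0 <= t then evolve t eta else nu eta + t * \sum_zeta nu zeta * rate eta zeta.

Lemma extended_evolveE (t : R) : 0 <= t -> extended_evolve t =1 evolve t.
Proof. by move=> t0 eta; rewrite /extended_evolve t0. Qed.

Lemma deriv_extended_evolve (t : R) eta : 0 <= t ->
  is_derive t 1 (extended_evolve ^~ eta)
    (\sum_xi extended_evolve t xi * ssep_generator rho (fun zeta => (zeta == eta)%:R) xi).
Proof.
move=> t0; rewrite (eq_bigr (fun xi => evolve t xi * rate eta xi)); last first.
  by move=> xi _; rewrite extended_evolveE.
set l := \sum_xi _.
suff lim : (fun h => h^-1 *: ((extended_evolve ^~ eta \o shift t) (h *: 1) -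
    extended_evolve t eta)) @ 0^' --> l.
  by apply: DeriveDef; [apply/cvg_ex; exists l | exact: cvg_lim].
apply: (@cvg_at_right_left_dnbhs _ R^o).
  have : \sum_xi evolve t xi * quot eta h xi @[h --> 0^'+] --> l.
    by apply: cvg_fin_sum => xi; apply: cvgM; [exact: cvg_cst | exact: quot_cvg].
  apply: cvg_trans; apply: near_eq_cvg; near=> h.
  have h0 : 0 < h by near: h; exact: nbhs_right_gt.
  rewrite /= /GRing.scale /= mulr1 !extended_evolveE ?addr_ge0 ?(ltW h0) //.
  rewrite [h + t]addrC increment ?(ltW h0) // mulr_sumr; apply: eq_bigr => xi _.
  by rewrite /quot; ring.
apply/cvg_at_leftNP; rewrite oppr0.
(* From the left at time 0, the difference quotient of the linear continuation is constantly [l]; at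
   a positive time it is the forward quotient started from [t - h], whose weights converge by left
   continuity. *)
move: t0; rewrite le_eqVlt => /orP[/eqP t0|t0].
  have : (fun=> l) h @[h --> (0 : R)^'+] --> l by exact: cvg_cst.
  apply: cvg_trans; apply: near_eq_cvg; near=> h.
  have h0 : 0 < h by near: h; exact: nbhs_right_gt.
  rewrite /= /GRing.scale /= mulr1 -t0 addr0 /extended_evolve lexx oppr_ge0.
  rewrite leNgt h0 /= evolve0 /l -t0.
  rewrite (eq_bigr (fun xi => nu xi * rate eta xi)); last by move=> xi _; rewrite evolve0.
  by field; rewrite gt_eqF.
have : \sum_xi evolve (t - h) xi * quot eta h xi @[h --> 0^'+] --> l.
  by apply: cvg_fin_sum => xi; apply: cvgM; [exact: evolve_left_cvg | exact: quot_cvg].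
apply: cvg_trans; apply: near_eq_cvg; near=> h.
have h0 : 0 < h by near: h; exact: nbhs_right_gt.
have ht : h < t by near: h; exact: nbhs_right_lt.
have th : 0 <= t - h by rewrite subr_ge0 ltW.
rewrite /= /GRing.scale /= mulr1 [- h + t]addrC !extended_evolveE // ?(ltW t0) //.
have -> : evolve (t - h) eta - evolve t eta = - (evolve (t - h + h) eta - evolve (t - h) eta).
  by rewrite subrK opprB.
rewrite increment ?(ltW h0) // invrN mulrNN mulr_sumr; apply: eq_bigr => xi _.
by rewrite /quot; ring.
Unshelve. all: by end_near. Qed.

End Forward.

(** * Lipschitz regularity of the initial profile *)

Lemma derivative01_is_derive (R : realType) (u : R -> R) (x l : R) :
  0 < x < 1 -> derivative01 u x l -> is_derive x 1 u l.
Proof.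
move=> x01 ul; apply/is_derive1_caratheodory.
exists (fun z => if z == x then l else (u z - u x) / (z - x)); split; last by rewrite eqxx.
  move=> z; case: eqP => [->|/eqP]; first by rewrite !subrr mulr0.
  by rewrite -subr_eq0 => /divfK.
apply/continuous_withinNx; rewrite eqxx.
have : (u y - u x) / (y - x) @[y --> x^'] --> l.
  apply: cvg_trans ul; apply: cvg_app; move=> A /= wA.
  have x01' : x \in `]0, 1[ by rewrite in_itv.
  have near01 : \forall y \near x^', y \in `]0, 1[.
    by apply: nbhs_dnbhs; exact: near_in_itvoo.
  near=> y.
  have y01 : y \in `]0, 1[ by near: y.
  have : `[0, 1]%classic y -> A y by near: y; exact: wA.
  apply; move: y01; rewrite /= !in_itv /= => /andP[y0 y1].
  by rewrite !ltW.
apply: cvg_trans; apply: near_eq_cvg; near=> y.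
have yx : y != x by near: y; exact: nbhs_dnbhs_neq.
by rewrite (negbTE yx).
Unshelve. all: by end_near. Qed.

Lemma derivative01_cvg (R : realType) (u : R -> R) (x l : R) :
  derivative01 u x l -> u y @[y --> within `[0, 1] x^'] --> u x.
Proof.
move=> ul.
have FF : Filter (within `[0, 1]%classic x^') by exact: within_filter.
have idc : (y - x) @[y --> within `[0, 1] x^'] --> (0 : R).
  rewrite -[X in _ --> X](subrr x); apply: cvgB; last exact: cvg_cst.
  by move=> A xA; apply: nbhs_dnbhs; apply: filterS xA => y Ay _.
have : (u y - u x) / (y - x) * (y - x) + u x @[y --> within `[0, 1] x^'] --> l * 0 + u x.
  by apply: cvgD; [apply: cvgM; [exact: ul | exact: idc] | exact: cvg_cst].
rewrite mulr0 add0r; apply: cvg_trans; apply: near_eq_cvg; near=> y.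
have yx : y != x by near: y; apply: filterS (nbhs_dnbhs_neq x).
by rewrite divfK ?subrK // subr_eq0.
Unshelve. all: by end_near. Qed.

(** By the mean value theorem: the derivative is two-sided in the open interval, and at 0 and 1 only
    the continuity that it implies is used. *)
Lemma profile_lipschitz (R : realType) (rho eps0 kappa : R) (u : R -> R) (x y : R) :
  profile_class rho eps0 kappa u -> 0 <= x -> x <= y -> y <= 1 ->
  `|u y - u x| <= kappa * (y - x).
Proof.
move=> [_ _ _ _ du] x0 xy y1.
have [dl dlP] : exists dl : R -> R, forall z, 0 <= z <= 1 ->
    derivative01 u z (dl z) /\ `|dl z| <= kappa.
  have /choice[dl dlP] : forall z : R, exists l : R, 0 <= z <= 1 ->
      derivative01 u z l /\ `|l| <= kappa.
    move=> z; have [/du [l]|] := pselect (0 <= z <= 1); first by exists l.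
    by exists 0.
  by exists dl.
have cont : {within `[0, 1], continuous u}.
  apply/continuous_within_itvP; first exact: ltr01.
  split.
  - move=> z; rewrite in_itv /= => z01.
    have zI : 0 <= z <= 1 by have /andP[z0 z1] := z01; rewrite !ltW.
    have [/(derivative01_is_derive z01) [dz _] _] := dlP z zI.
    exact/differentiable_continuous/derivable1_diffP.
  - have [/derivative01_cvg + _] := dlP 0 (introT andP (conj (lexx 0) ler01)).
    apply: cvg_trans; apply: cvg_app => A /= wA.
    have n1 : \forall z \near (0 : R)^'+, `[0, 1]%classic z -> A z.
      apply: (@filterS _ (nbhs (0 : R)) _ _ _ _ wA) => z zA z0.
      by apply: zA; rewrite gt_eqF.
    near=> z; have : `[0, 1]%classic z -> A z by near: z.
    apply; rewrite /= in_itv /=; apply/andP; split; apply: ltW.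
      by near: z; exact: nbhs_right_gt.
    by near: z; exact: nbhs_right_lt.
  - have [/derivative01_cvg + _] := dlP 1 (introT andP (conj ler01 (lexx 1))).
    apply: cvg_trans; apply: cvg_app => A /= wA.
    have n1 : \forall z \near (1 : R)^'-, `[0, 1]%classic z -> A z.
      apply: (@filterS _ (nbhs (1 : R)) _ _ _ _ wA) => z zA z1.
      by apply: zA; rewrite lt_eqF.
    near=> z; have : `[0, 1]%classic z -> A z by near: z.
    apply; rewrite /= in_itv /=; apply/andP; split; apply: ltW.
      by near: z; exact: nbhs_left_gt.
    by near: z; exact: nbhs_left_lt.
have y_le1 : `[x, y]%classic `<=` `[0, 1]%classic.
  move=> z /=; rewrite !in_itv /= => /andP[h1 h2].
  by rewrite (le_trans x0 h1) (le_trans h2 y1).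
have [c cxy ->] : exists2 c, c \in `[x, y] & u y - u x = dl c * (y - x).
  apply: MVT_segment => //; last exact: continuous_subspaceW cont.
  move=> z; rewrite in_itv /= => /andP[h1 h2].
  have z01 : 0 < z < 1 by rewrite (le_lt_trans x0 h1) (lt_le_trans h2 y1).
  apply: derivative01_is_derive => //.
  by case: (dlP z) => //; have /andP[z0 z1] := z01; rewrite !ltW.
have cI : 0 <= c <= 1 by have := y_le1 _ cxy; rewrite /= in_itv.
rewrite normrM [`|y - x|]ger0_norm ?subr_ge0 //.
by apply: ler_wpM2r; [rewrite subr_ge0 | case: (dlP c cI)].
Unshelve. all: by end_near. Qed.

(** From [ln f <= f - 1] one gets [f ln f <= f^2 - f]; integrate against [nu]. Points where [mu]
    vanishes contribute zero to both sides. *)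
Lemma entropy_le_chi2 (R : realType) (n : nat) (nu mu : config n -> R) :
  (forall eta, 0 < nu eta) -> (forall eta, 0 <= mu eta) -> \sum_eta mu eta = 1 ->
  relative_entropy nu (rnderiv mu nu) <= \sum_eta mu eta ^+ 2 / nu eta - 1.
Proof.
move=> nu0 mu0 mu1; rewrite -mu1 -sumrB; apply: ler_sum => eta _.
have n0 := nu0 eta; have := mu0 eta; rewrite /rnderiv le_eqVlt => /orP[/eqP <-|m0].
  by rewrite mul0r mul0r mulr0 expr0n mul0r subrr.
set f := mu eta / nu eta; have f0 : 0 < f by rewrite divr_gt0.
have lnf : ln f <= f - 1.
  by rewrite -[f in ln f](subrKC 1); apply: le_ln1Dx; lra.
have -> : mu eta ^+ 2 / nu eta - mu eta = nu eta * (f * (f - 1)).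
  by rewrite /f; field; rewrite gt_eqF.
by rewrite ler_pM2l // ler_pM2l.
Qed.

Lemma markov_law (R : realType) (M : nat) (rho : R) (nu : config M.+2 -> R)
    (d : measure_display) (T : measurableType d) (P : probability T R)
    (X : R -> {RV P >-> config M.+2}) :
  markov_chain X (@ssep_generator R rho M.+2) nu ->
  exists p, [/\ transition_function p, has_generator p (@ssep_generator R rho M.+2) &
    forall (t : R) eta, 0 <= t -> law X t eta = evolve p nu t eta].
Proof.
move=> [init [p [p_trans p_gen mark]]]; exists p; split=> // t eta t0.
rewrite lawE (probability_partition (X 0)); last exact: measurable_preimage.
apply: eq_bigr => xi _.
(* With an empty past and starting time 0, the Markov property gives the joint law of the states at
   times 0 and [t]. *)
have := mark [::] 0 t xi eta (lexx 0) t0 (fun q => _); rewrite /= subr0.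
set past := _ `&` X 0 @^-1` [set xi].
have -> : past = X 0 @^-1` [set xi] by rewrite /past; apply/seteqP; split=> [w []//|w]; split.
by rewrite setIC init => -> //.
Qed.

Theorem theorem3p2 (R : realType) (rho eps0 kappa : R)
    (rho01 : 0 < rho < 1)
    (eps0_gt0 : 0 < eps0) (eps0_le : eps0 <= Num.min rho (1 - rho))
    (kappa_ge0 : 0 <= kappa) :
  exists C0 delta0 : R, 0 < delta0 /\
    forall (n : nat) (u0 : R -> R), (2 <= n)%N ->
      profile_class rho eps0 kappa u0 ->
      forall (d : measure_display) (T : measurableType d)
             (P : probability T R) (X : R -> {RV P >-> config n}),
        markov_chain X (@ssep_generator R rho n) (@initial_law R n u0) ->
        forall t : R, 0 <= t ->
          relative_entropy (reference_law X t)
            (rnderiv (law X t) (reference_law X t))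
          <= C0 * expR (- (delta0 * t)).
Proof.
have rho_int : eps0 <= rho <= 1 - eps0.
  by move: eps0_le; rewrite le_min => /andP[h1 h2]; apply/andP; split => //; lra.
have [C [delta [delta_gt0 decay]]] := chi2_decay eps0_gt0 rho_int kappa_ge0.
exists C, delta; split=> // n u0 n2 u0_class d T P X.
case: n n2 X => [|[|M]] // _ X mc t t0.
pose v0 (x : lattice M.+2) := u0 ((site x)%:R / M.+2%:R).
have [u0_01 u0_int u00 u01 _] := u0_class.
have n0 : 0 < M.+2%:R :> R by rewrite ltr0n.
have v0_int x : eps0 <= v0 x <= 1 - eps0.
  apply: u0_int; rewrite divr_ge0 //= ler_pdivrMr // mul1r ler_nat.
  by rewrite /site ltnW // ltnS.
(* Because [u0] equals [rho] at 0 and 1, the extension by the reservoir density samples [u0] at the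
   end points too, and one Lipschitz bound covers all differences. *)
have extE k : (k <= M.+2)%N -> ext_profile rho v0 k = u0 (k%:R / M.+2%:R).
  rewrite /ext_profile; case: ifP => [/andP[k0 kM] _|/negbT].
    by rewrite /v0 /site pt_val ?prednK // -ltnS prednK.
  rewrite negb_and -leqNgt leqn0 -ltnNge => /orP[/eqP ->|Mk] kM.
    by rewrite mul0r u00.
  have -> : k = M.+2 by apply/eqP; rewrite eqn_leq kM Mk.
  by rewrite divff ?gt_eqF.
have v0_lip k : (k <= M.+1)%N ->
    `|ext_profile rho v0 k.+1 - ext_profile rho v0 k| <= kappa / M.+2%:R.
  move=> kM; rewrite !extE //; last exact: leqW.
  have -> : kappa / M.+2%:R = kappa * (k.+1%:R / M.+2%:R - k%:R / M.+2%:R).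
    by rewrite -mulrBl -natrB // subSnn mul1r.
  apply: profile_lipschitz u0_class _ _ _; first by rewrite divr_ge0.
    by rewrite ler_pM2r ?invr_gt0 // ler_nat.
  by rewrite ler_pdivrMr // mul1r ler_nat.
have [p [p_trans p_gen lawP]] := markov_law mc.
have nu_ge0 eta : 0 <= @initial_law R M.+2 u0 eta.
  exact/ltW/(bernoulli_gt0 eps0_gt0 v0_int).
have nu_sum : \sum_eta @initial_law R M.+2 u0 eta = 1.
  rewrite -[RHS](expect_cst v0); apply: eq_bigr => eta _; by rewrite mulr1.
pose m := extended_evolve rho p (@initial_law R M.+2 u0).
have m_law (s : R) : 0 <= s -> m s =1 law X s.
  by move=> s0 eta; rewrite /m extended_evolveE // lawP.
have m_deriv (s : R) eta : 0 <= s -> is_derive s 1 (m ^~ eta)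
    (\sum_xi m s xi * ssep_generator rho (fun zeta => (zeta == eta)%:R) xi).
  by move=> s0; exact: deriv_extended_evolve.
have m_sum (s : R) : 0 <= s -> \sum_eta m s eta = 1.
  move=> s0; rewrite -(evolve_sum p_trans nu_sum s0); apply: eq_bigr => eta _.
  by rewrite /m extended_evolveE.
have m_init : m 0 =1 bernoulli_product v0.
  by move=> eta; rewrite /m extended_evolveE // evolve0.
have lawE' : law X t = m t by apply/funext => eta; rewrite m_law.
have refE : reference_law X t = bernoulli_product (density m t).
  congr bernoulli_product; apply/funext => x.
  by rewrite mean_densityE; apply: eq_bigr => eta _; rewrite m_law.
rewrite lawE' refE; apply: le_trans (decay M m v0 m_deriv m_sum m_init v0_int v0_lip t t0).
apply: entropy_le_chi2 => [eta|eta|].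
- apply: (bernoulli_gt0 eps0_gt0) => x.
  exact: (density_interior rho_int m_deriv m_sum m_init v0_int).
- by rewrite /m extended_evolveE // evolve_ge0.
- exact: m_sum.
Qed.
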